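(* Let $k$ be a field, let $\Gamma$ be a subgroup of an abelian group $\Lambda$, and let $\pi:\Lambda\to\bar\Lambda$ be a group epimorphism onto an abelian group $\bar\Lambda$ with $\ker(\pi)=\Gamma$; write $\bar\lambda=\pi(\lambda)$. Let $\mathfrak A(\bar\Lambda)$ be the class of $\bar\Lambda$-graded $k$-algebras $\mathcal A$ such that $\mathcal A$ is central-simple as an algebra. Let $\mathfrak B(\Lambda,\Gamma)$ be the class of $\Lambda$-graded $k$-algebras $\mathcal B$ such that $\mathcal B$ is graded-central-simple, $C(\mathcal B)$ is split and $\Gamma(\mathcal B)=\Gamma$. For a $\bar\Lambda$-graded algebra $\mathcal A$ let $L_\pi(\mathcal A)=\sum_{\lambda\in\Lambda}\mathcal A^{\bar\lambda}\otimes z^\lambda\subseteq \mathcal A\otimes_k k[\Lambda]$, a $\Lambda$-graded algebra. (i) If $\mathcal A\in\mathfrak A(\bar\Lambda)$, then $L_\pi(\mathcal A)\in\mathfrak B(\Lambda,\Gamma)$. (ii) If $\mathcal B\in\mathfrak B(\Lambda,\Gamma)$, then there exists $\mathcal A\in\mathfrak A(\bar\Lambda)$ such that $L_\pi(\mathcal A)\simeq_\Lambda\mathcal B$. Moreover, the $\bar\Lambda$-graded algebras $\mathcal A$ with this property are precisely the central images of $\mathcal B$. (iii) If $\mathcal A,\mathcal A'\in\mathfrak A(\bar\Lambda)$, then $L_\pi(\mathcal A)\simeq_\Lambda L_\pi(\mathcal A')$ if and only if $\mathcal A\sim_\pi\mathcal A'$. (iv) If $\mathcal A\in\mathfrak A(\bar\Lambda)$,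 $\mathcal B\in\mathfrak B(\Lambda,\Gamma)$ and $\mathcal B\simeq_\Lambda L_\pi(\mathcal A)$, then $\mathcal A$ is finite dimensional if and only if $\mathcal B$ is fgc.
   Context: $k$ is an arbitrary field; all algebras are over $k$ and not necessarily associative or unital. For an abelian group $\Lambda$, a $\Lambda$-graded algebra is an algebra $\mathcal B=\bigoplus_{\lambda\in\Lambda}\mathcal B^\lambda$ with $\mathcal B^\lambda\mathcal B^\mu\subseteq\mathcal B^{\lambda+\mu}$. $\mathcal B\simeq_\Lambda\mathcal B'$ means there is an algebra isomorphism $\varphi:\mathcal B\to\mathcal B'$ with $\varphi(\mathcal B^\lambda)=\mathcal B'^\lambda$ for all $\lambda$ (similarly $\simeq_{\bar\Lambda}$). $k[\Lambda]=\bigoplus_\lambda kz^\lambda$ is the group algebra, $z^\lambda z^\mu=z^{\lambda+\mu}$, graded by $k[\Lambda]^\lambda=kz^\lambda$. The loop algebra $L_\pi(\mathcal A)$ is graded by $L_\pi(\mathcal A)^\lambda=\mathcal A^{\bar\lambda}\otimes z^\lambda$. Centroid: $\mathrm{Mult}(\mathcal B)\subseteq\mathrm{End}_k(\mathcal B)$ is the unital subalgebra generated by all left and right multiplications by elements of $\mathcal B$; the centroid $C(\mathcal B)$ is its centralizer in $\mathrm{End}_k(\mathcal B)$. If $\mathcal B$ is $\Lambda$-graded, $C(\mathcal B)^\lambda=\{c\in C(\mathcal B): c(\mathcal B^\mu)\subseteq\mathcal B^{\lambda+\mu}\ \forall\mu\in\Lambda\}$. $\mathcal B$ is simple (resp.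 graded-simple) if $\mathcal B\mathcal B\ne0$ and its only ideals (resp. graded ideals) are $0$ and $\mathcal B$; central if $C(\mathcal B)=k1$; graded-central if $C(\mathcal B)^0=k1$; central-simple = central and simple; graded-central-simple = graded-central and graded-simple. For $\mathcal B$ graded-simple, $C(\mathcal B)=\bigoplus_\lambda C(\mathcal B)^\lambda$ and $\Gamma(\mathcal B)=\{\lambda\in\Lambda: C(\mathcal B)^\lambda\ne0\}$ is a subgroup of $\Lambda$. For $\mathcal B$ graded-central-simple, $C(\mathcal B)$ is split if $C(\mathcal B)\simeq_\Lambda k[\Gamma(\mathcal B)]$. $\mathcal B$ is fgc if it is finitely generated as a $C(\mathcal B)$-module. Central images (relative to $\pi$): let $\mathrm{Alg}(C(\mathcal B),k)$ be the set of unital $k$-algebra homomorphisms $C(\mathcal B)\to k$. For $\rho$ in this set, a $\rho$-specialization of the $\Lambda$-graded algebra $\mathcal B$ is a nonzero algebra epimorphism $\varphi:\mathcal B\to\mathcal A$ onto a $\bar\Lambda$-graded algebra $\mathcal A$ with $\varphi(\mathcal B^\lambda)\subseteq\mathcal A^{\bar\lambda}$ for $\lambda\in\Lambda$ and $\varphi(cx)=\rho(c)\varphi(x)$ for $c\in C(\mathcal B)$, $x\in\mathcal B$; then $\mathcal A$ is called a $\rho$-image of $\mathcal B$. A central image of $\mathcal B$ is a $\rho$-image for some $\rho\in\mathrm{Alg}(C(\mathcal B),k)$. Similarity: fix a map of sets $\xi:\bar\Lambda\to\Lambda$ with $\pi\circ\xi=1_{\bar\Lambda}$. For $\chi\in\mathrm{Hom}(\Gamma,k^\times)$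 and a $\bar\Lambda$-graded algebra $\mathcal A$, the twist $\mathcal A_\chi$ is the graded vector space $\mathcal A$ with product $u\cdot_\chi v=\chi(\xi(\bar\lambda)+\xi(\bar\mu)-\xi(\bar\lambda+\bar\mu))\,uv$ for $u\in\mathcal A^{\bar\lambda}$, $v\in\mathcal A^{\bar\mu}$ (up to $\bar\Lambda$-graded isomorphism independent of $\xi$). $\mathcal A\sim_\pi\mathcal A'$ means $\mathcal A'\simeq_{\bar\Lambda}\mathcal A_\chi$ for some $\chi\in\mathrm{Hom}(\Gamma,k^\times)$. *)

(* Defs.v *)
From HB Require Import structures.
From mathcomp Require Import all_boot all_algebra sesquilinear.
From mathcomp Require Import finmap boolp classical_sets functions.
From mathcomp.multinomials Require Import monalg.

Set Implicit Arguments.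
Unset Strict Implicit.
Unset Printing Implicit Defensive.

Import GRing.Theory.

Local Open Scope ring_scope.

Section Subspaces.
Context {k : fieldType} {V : lmodType k}.

Definition is_subspace (S : set V) : Prop :=
  S 0 /\ forall (a : k) x y, S x -> S y -> S (a *: x + y).

Definition subspace_pred (S : set V) (hS : is_subspace S) : {pred V} :=
  fun x => `[< S x >].

Lemma subspace_closed (S : set V) (hS : is_subspace S) :
  submod_closed (subspace_pred hS).
Proof.
case: (hS) => S0 SP; split; first exact/asboolP.
by move=> a x y /asboolP Sx /asboolP Sy; apply/asboolP; apply: SP.
Qed.

HB.instance Definition _ (S : set V) (hS : is_subspace S) :=
  GRing.isSubmodClosed.Build k V (subspace_pred hS)
    (subspace_closed hS).

Record subspace_type (S : set V) (hS : is_subspace S) := SubspaceElt {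
  elt_val :> V;
  elt_valP : elt_val \in subspace_pred hS
}.

HB.instance Definition _ (S : set V) (hS : is_subspace S) :=
  [isSub for @elt_val S hS].
HB.instance Definition _ (S : set V) (hS : is_subspace S) :=
  [Choice of subspace_type hS by <:].
HB.instance Definition _ (S : set V) (hS : is_subspace S) :=
  [SubChoice_isSubZmodule of subspace_type hS by <:].
HB.instance Definition _ (S : set V) (hS : is_subspace S) :=
  [SubZmodule_isSubLmodule of subspace_type hS by <:].

Lemma subspace_eltP (S : set V) (hS : is_subspace S) (x : subspace_type hS) :
  S (elt_val x).
Proof. exact/asboolP/elt_valP. Qed.

Definition mk_elt (S : set V) (hS : is_subspace S) (x : V) (Sx : S x) :
  subspace_type hS := @SubspaceElt S hS x (asboolT Sx).

End Subspaces.

(* The direct sum of copies of [V] indexed by [L]: finitely supported functions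
   [L -> V] with the pointwise vector space structure.  An alias is needed
   because the library makes [{malg V[L]}] a module only when [V] is a ring. *)
Definition dirsum (k : fieldType) (V : lmodType k) (L : choiceType) : Type :=
  {malg V[L]}.

Section DirectSum.
Context {k : fieldType} {V : lmodType k} {L : choiceType}.

HB.instance Definition _ := GRing.Zmodule.on (dirsum V L).

Definition dscale (c : k) (f : dirsum V L) : dirsum V L :=
  \sum_(l <- msupp f) << c *: f@_l *g l >>.

Lemma mcoeff_sumU (D : {fset L}) (F : L -> V) m :
  (\sum_(l <- D) << F l *g l >>)@_m = if m \in D then F m else 0.
Proof.
rewrite raddf_sum /=; case: ifPn => mD.
  rewrite (big_fsetD1 m) //= mcoeffUU big_seq big1 ?addr0 // => l.
  by rewrite in_fsetD1 => /andP[lm _]; rewrite mcoeffU (negPf lm).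
rewrite big_seq big1 // => l lD; rewrite mcoeffU.
by case: eqVneq => // lm; rewrite -lm lD in mD.
Qed.

Lemma dscaleE c (f : dirsum V L) l : (dscale c f)@_l = c *: f@_l.
Proof.
rewrite /dscale mcoeff_sumU; case: ifPn => // /mcoeff_outdom ->.
by rewrite scaler0.
Qed.

Lemma dscaleA c d (f : dirsum V L) : dscale c (dscale d f) = dscale (c * d) f.
Proof. by apply/malgP => l; rewrite !dscaleE scalerA. Qed.

Lemma dscale1 : left_id 1 dscale.
Proof. by move=> f; apply/malgP => l; rewrite dscaleE scale1r. Qed.

Lemma dscaleDr : right_distributive dscale +%R.
Proof.
by move=> c f g; apply/malgP => l; rewrite mcoeffD !dscaleE mcoeffD scalerDr.
Qed.

Lemma dscaleDl (f : dirsum V L) : {morph dscale^~ f : c d / c + d}.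
Proof.
by move=> c d; apply/malgP => l; rewrite mcoeffD !dscaleE scalerDl.
Qed.

HB.instance Definition _ := GRing.Zmodule_isLmodule.Build k (dirsum V L)
  dscaleA dscale1 dscaleDr dscaleDl.

Lemma mcoeffZ c (f : dirsum V L) l : (c *: f)@_l = c *: f@_l.
Proof. exact: dscaleE. Qed.

Definition single (l : L) (v : V) : dirsum V L := << v *g l >>.

Lemma single_linear l : linear (single l).
Proof.
move=> c u v; apply/malgP => m; rewrite mcoeffD mcoeffZ !mcoeffU.
by case: eqP => _; rewrite ?mulr1n ?mulr0n ?scaler0 ?addr0.
Qed.

HB.instance Definition _ l :=
  GRing.isLinear.Build k V (dirsum V L) *:%R (single l) (single_linear l).

Lemma dirsumE (f : dirsum V L) : f = \sum_(l <- msupp f) single l f@_l.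
Proof. exact: monalgE. Qed.

End DirectSum.

Section BilinearSum.
Context {k : fieldType} {V U W : lmodType k} {L : choiceType}.

Definition bisum (g : L -> L -> V -> U -> W) (f : dirsum V L) (h : dirsum U L)
  : W := \sum_(l <- msupp f) \sum_(m <- msupp h) g l m f@_l h@_m.

Variable g : L -> L -> V -> U -> W.
Hypothesis g_bilinear : forall l m, bilinear_for *:%R *:%R (g l m).

Let g0l l m u : g l m 0 u = 0.
Proof.
have := (g_bilinear l m).1 u (-1) 0 0.
by rewrite /= scaler0 add0r scaleN1r addNr.
Qed.

Let g0r l m v : g l m v 0 = 0.
Proof.
have := (g_bilinear l m).2 v (-1) 0 0.
by rewrite /= scaler0 add0r scaleN1r addNr.
Qed.

Lemma bisumEw (f : dirsum V L) (h : dirsum U L) (D E : {fset L}) :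
  (msupp f `<=` D)%fset -> (msupp h `<=` E)%fset ->
  bisum g f h = \sum_(l <- D) \sum_(m <- E) g l m f@_l h@_m.
Proof.
move=> fD hE; rewrite /bisum (big_fset_incl _ fD) => [|l _ lf].
  apply: eq_bigr => l _; apply: big_fset_incl => // m _ mh.
  by rewrite (mcoeff_outdom mh) g0r.
by apply: big1 => m _; rewrite (mcoeff_outdom lf) g0l.
Qed.

Lemma bisum_bilinear : bilinear_for *:%R *:%R (bisum g).
Proof.
split=> [h c f f'|f c h h'] /=.
  pose D := (msupp f `|` msupp f' `|` msupp (c *: f + f'))%fset.
  have s1 : (msupp f `<=` D)%fset.
    by rewrite /D -fsetUA fsubsetUl.
  have s2 : (msupp f' `<=` D)%fset.
    by rewrite /D (fsetUC (msupp f)) -fsetUA fsubsetUl.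
  have s3 : (msupp (c *: f + f') `<=` D)%fset by rewrite fsubsetUr.
  have s0 := fsubset_refl (msupp h).
  rewrite (bisumEw s1 s0) (bisumEw s2 s0) (bisumEw s3 s0).
  rewrite scaler_sumr -big_split /=; apply: eq_bigr => l _.
  rewrite scaler_sumr -big_split /=; apply: eq_bigr => m _.
  by rewrite mcoeffD mcoeffZ (g_bilinear l m).1.
pose D := (msupp h `|` msupp h' `|` msupp (c *: h + h'))%fset.
have s1 : (msupp h `<=` D)%fset.
  by rewrite /D -fsetUA fsubsetUl.
have s2 : (msupp h' `<=` D)%fset.
  by rewrite /D (fsetUC (msupp h)) -fsetUA fsubsetUl.
have s3 : (msupp (c *: h + h') `<=` D)%fset by rewrite fsubsetUr.
have s0 := fsubset_refl (msupp f).
rewrite (bisumEw s0 s1) (bisumEw s0 s2) (bisumEw s0 s3).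
rewrite scaler_sumr -big_split /=; apply: eq_bigr => l _.
rewrite scaler_sumr -big_split /=; apply: eq_bigr => m _.
by rewrite mcoeffD mcoeffZ (g_bilinear l m).2.
Qed.

Lemma bisum_single l m v u : bisum g (single l v) (single m u) = g l m v u.
Proof.
rewrite (@bisumEw _ _ [fset l]%fset [fset m]%fset) ?msuppU_le //.
by rewrite !big_seq_fset1 !mcoeffUU.
Qed.

End BilinearSum.

(* Not necessarily associative or unital. *)
Record algebra (k : fieldType) := Algebra {
  acarrier :> lmodType k;
  amul : {bilinear acarrier -> acarrier -> acarrier}
}.
Arguments amul {k a}.

Notation "x ** y" := (amul x y) (at level 40, left associativity) : ring_scope.

Definition mk_algebra (k : fieldType) (V : lmodType k) (m : V -> V -> V)
    (mP : bilinear_for *:%R *:%R m) : algebra k :=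
  Algebra (HB.pack_for {bilinear V -> V -> V} m
    (@bilinear_isBilinear.Build k V V V *:%R *:%R m mP)).

Section Subalgebras.
Context {k : fieldType} {B : algebra k}.

Definition mul_closed (S : set B) : Prop :=
  forall x y, S x -> S y -> S (x ** y).

Variables (S : set B) (hS : is_subspace S) (mS : mul_closed S).

Definition sub_mul (x y : subspace_type hS) : subspace_type hS :=
  mk_elt hS (mS (subspace_eltP x) (subspace_eltP y)).

Lemma sub_mul_bilinear : bilinear_for *:%R *:%R sub_mul.
Proof.
split=> [y c x x'|x c y y']; apply: val_inj => /=.
  exact: (linearPl amul).
exact: (linearPr amul).
Qed.

Definition subalgebra : algebra k := mk_algebra sub_mul_bilinear.

End Subalgebras.

Section Ideals.
Context {k : fieldType} (B : algebra k).

Definition is_ideal (I : set B) : Prop :=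
  is_subspace I /\ forall b x, I x -> I (b ** x) /\ I (x ** b).

Definition nonzero_mul : Prop := exists x y : B, x ** y != 0.

Definition simple_alg : Prop :=
  nonzero_mul /\
  forall I : set B, is_ideal I -> I = [set 0]%classic \/ I = setT.

End Ideals.

Section Centroid.
Context {k : fieldType}.

Definition linear_set (V : lmodType k) : set (V -> V) := fun f => linear f.

Lemma linear_set_subspace (V : lmodType k) : is_subspace (@linear_set V).
Proof.
split=> [c x y|a f g fl gl c x y] /=.
  by rewrite scaler0 addr0.
rewrite !fctE fl gl !scalerDr !scalerA (mulrC a) -!scalerA.
by rewrite -!addrA; congr (_ + _); rewrite addrCA.
Qed.

Definition endo (V : lmodType k) := subspace_type (@linear_set_subspace V).

Definition endo_fun (V : lmodType k) (f : endo V) : V -> V := elt_val f.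

Definition mk_endo (V : lmodType k) (f : V -> V) (fl : linear f) : endo V :=
  @mk_elt k (V -> V) (@linear_set V) (@linear_set_subspace V) f fl.

Lemma endoP (V : lmodType k) (f : endo V) : linear (endo_fun f).
Proof. exact: (subspace_eltP f). Qed.

Lemma comp_linear (V : lmodType k) (f g : endo V) : linear (endo_fun f \o endo_fun g).
Proof. by move=> c x y /=; rewrite (endoP g) (endoP f). Qed.

Definition endo_mul (V : lmodType k) (f g : endo V) : endo V :=
  mk_endo (comp_linear f g).

Lemma endo_mul_bilinear (V : lmodType k) :
  bilinear_for *:%R *:%R (@endo_mul V).
Proof.
split=> [g c f f'|f c g g']; apply: val_inj => //=.
by apply/funext => x /=; exact: (endoP f).
Qed.

Definition endo_alg (V : lmodType k) : algebra k :=
  mk_algebra (@endo_mul_bilinear V).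

Lemma id_linear (V : lmodType k) : linear (@idfun V).
Proof. by []. Qed.

Definition endo1 (V : lmodType k) : endo_alg V := mk_endo (@id_linear V).

Variable B : algebra k.

Definition lmult (b : B) : endo_alg B := mk_endo (linearPr amul b).
Definition rmult (b : B) : endo_alg B := mk_endo (linearPl amul b).

Definition unital_subalgebra (S : set (endo_alg B)) : Prop :=
  [/\ is_subspace S, S (endo1 B) & mul_closed S].

Definition mult_alg : set (endo_alg B) :=
  smallest unital_subalgebra
    (fun f => exists b, f = lmult b \/ f = rmult b).

Definition centroid_set : set (endo_alg B) :=
  fun c => forall m, mult_alg m -> c ** m = m ** c.

Lemma centroid_subspace : is_subspace centroid_set.
Proof.
split=> [m _|a c d Cc Cd m Mm]; first by rewrite (linear0l amul) (linear0r amul).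
by rewrite (linearPl amul) (linearPr amul) Cc // Cd.
Qed.

Lemma centroid_mul_closed : mul_closed centroid_set.
Proof.
move=> c d Cc Cd m Mm; apply: val_inj; apply/funext => x.
rewrite -[LHS]/(endo_fun (c ** d ** m) x) -[RHS]/(endo_fun (m ** (c ** d)) x).
have E (e : endo_alg B) y : centroid_set e ->
    endo_fun e (endo_fun m y) = endo_fun m (endo_fun e y).
  by move=> /(_ m Mm) /(congr1 (fun h : endo_alg B => endo_fun h y)).
have -> : endo_fun (c ** d ** m) x = endo_fun c (endo_fun d (endo_fun m x)) by [].
by rewrite (E d) // (E c).
Qed.

Definition centroid : algebra k :=
  subalgebra centroid_subspace centroid_mul_closed.

End Centroid.

Arguments mult_alg {k} B _.
Arguments centroid_set {k} B _.
Arguments centroid_subspace {k} B.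
Arguments centroid {k} B.

Section CentroidElements.
Context {k : fieldType} {B : algebra k}.

Definition centroid_endo (c : centroid B) : endo_alg B := elt_val c.

Definition centroid_act (c : centroid B) (x : B) : B :=
  endo_fun (centroid_endo c) x.

Lemma centroid1_subproof : centroid_set B (endo1 B).
Proof. by move=> m _; apply: val_inj. Qed.

Definition centroid1 : centroid B :=
  mk_elt (centroid_subspace B) centroid1_subproof.

End CentroidElements.

Definition central_alg (k : fieldType) (B : algebra k) : Prop :=
  centroid_set B = range (fun a : k => a *: endo1 B).

Definition central_simple (k : fieldType) (B : algebra k) : Prop :=
  central_alg B /\ simple_alg B.

Definition finite_dimensional (k : fieldType) (V : lmodType k) : Prop :=
  exists n (e : 'I_n -> V), forall x,
    exists a : 'I_n -> k, x = \sum_i a i *: e i.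

Definition fgc (k : fieldType) (B : algebra k) : Prop :=
  exists n (e : 'I_n -> B), forall x,
    exists c : 'I_n -> centroid B, x = \sum_i centroid_act (c i) (e i).

Section Gradings.
Context {k : fieldType} {L : choiceType}.

(* This is the sum of the [F l] when they are subspaces; as [s] may omit indices,
   an empty [F l] contributes nothing. *)
Definition family_sum (V : lmodType k) (F : L -> set V) : set V := fun x =>
  exists (s : seq L) (f : L -> V),
    (forall l, l \in s -> F l (f l)) /\ x = \sum_(l <- s) f l.

Definition is_direct_sum (V : lmodType k) (F : L -> set V) : Prop :=
  (forall l, is_subspace (F l)) /\
  forall x, exists! f : dirsum V L,
    (forall l, F l f@_l) /\ x = \sum_(l <- msupp f) f@_l.

Definition graded_isom (A A' : algebra k) (F : L -> set A) (F' : L -> set A')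
  : Prop :=
  exists phi : {linear A -> A'},
    [/\ bijective phi, {morph phi : x y / x ** y} &
        forall l, image (F l) phi = F' l].

End Gradings.

Record graded_algebra (k : fieldType) (L : zmodType) := GradedAlgebra {
  galg :> algebra k;
  gcomp : L -> set galg;
  gcomp_direct : is_direct_sum gcomp;
  gcompM : forall l m x y, gcomp l x -> gcomp m y -> gcomp (l + m) (x ** y)
}.
Arguments gcomp {k L} _ l _.

Definition giso (k : fieldType) (L : zmodType) (A A' : graded_algebra k L) :
  Prop := graded_isom (gcomp A) (gcomp A').

Section GroupAlgebra.
Context (k : fieldType) (L : zmodType).

Lemma group_mul_subproof (l m : L) :
  bilinear_for *:%R *:%R
    (fun a b : k^o => single (l + m) (a * b : k^o) : dirsum k^o L).
Proof.
split=> [b c a a'|a c b b'] /=.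
  by rewrite -linearP /= mulrDl -scalerAl.
by rewrite -linearP /= mulrDr -scalerAr.
Qed.

Definition group_mul : dirsum k^o L -> dirsum k^o L -> dirsum k^o L :=
  bisum (fun l m (a b : k^o) => single (l + m) (a * b : k^o)).

Definition group_alg : algebra k :=
  mk_algebra (bisum_bilinear group_mul_subproof : bilinear_for _ _ group_mul).

Definition zpow (l : L) : group_alg := single l (1 : k^o).

Lemma zpowM l m : zpow l ** zpow m = zpow (l + m).
Proof.
apply: etrans (bisum_single group_mul_subproof l m 1 1) _.
by rewrite mulr1.
Qed.

Definition gcoef (l : L) (x : group_alg) : k^o := mcoeff l (x : dirsum k^o L).

Lemma gcoef_linear l : linear (gcoef l).
Proof. by move=> c x y; rewrite /gcoef mcoeffD mcoeffZ. Qed.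

HB.instance Definition _ l :=
  GRing.isLinear.Build k group_alg k^o *:%R (gcoef l) (gcoef_linear l).

Lemma gcoef_zpow l m : gcoef l (zpow m) = (m == l)%:R.
Proof. exact: mcoeffU. Qed.

Lemma group_algP x y : (forall l, gcoef l x = gcoef l y) -> x = y.
Proof. by move=> xy; apply/malgP. Qed.

Lemma group_algE (x : group_alg) :
  x = \sum_(l <- msupp (x : dirsum k^o L)) gcoef l x *: zpow l.
Proof.
rewrite [LHS](dirsumE (x : dirsum k^o L)); apply: eq_bigr => l _.
apply: group_algP => m; rewrite linearZ /= gcoef_zpow /gcoef mcoeffU.
by rewrite -[RHS]/(_ * _) mulr_natr.
Qed.

Lemma group_alg_ext (W : lmodType k) (f g : group_alg -> W) :
  linear f -> linear g -> (forall l, f (zpow l) = g (zpow l)) -> f =1 g.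
Proof.
move=> fl gl fg x.
pose f' : {linear group_alg -> W} := HB.pack_for {linear group_alg -> W} f
  (GRing.isLinear.Build k group_alg W *:%R f fl).
pose g' : {linear group_alg -> W} := HB.pack_for {linear group_alg -> W} g
  (GRing.isLinear.Build k group_alg W *:%R g gl).
rewrite -[LHS]/(f' x) -[RHS]/(g' x) (group_algE x) !linear_sum.
by apply: eq_bigr => l _; rewrite !linearZ /= fg.
Qed.

(* k[G] is realised as the span of the z^g, g in G, inside k[L]. *)
Variable G : zmodClosed L.

Definition group_alg_on_set : set group_alg :=
  family_sum (fun l x => l \in G /\ exists a : k, x = a *: zpow l).

Lemma group_alg_onE (x : group_alg) :
  group_alg_on_set x <-> forall l, l \notin G -> gcoef l x = 0.
Proof.
split=> [[s [f [fP ->]]] l lG|xG].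
  rewrite linear_sum big_seq; apply: big1 => m /fP[mG [a ->]].
  rewrite linearZ /= gcoef_zpow; case: eqVneq => [ml|_]; last by rewrite scaler0.
  by rewrite ml (negPf lG) in mG.
exists (msupp (x : dirsum k^o L)), (fun l => gcoef l x *: zpow l).
split=> [l lx|].
  split; last by exists (gcoef l x).
  by apply: contraTT lx => /xG x0; rewrite -mcoeff_eq0 [_@__]x0.
exact: group_algE.
Qed.

Lemma group_alg_on_subspace : is_subspace group_alg_on_set.
Proof.
split=> [|a x y /group_alg_onE xG /group_alg_onE yG]; apply/group_alg_onE.
  by move=> l _; rewrite linear0.
by move=> l lG; rewrite linearP /= xG // yG // scaler0 addr0.
Qed.

Lemma group_alg_on_mul_closed : mul_closed group_alg_on_set.
Proof.
move=> x y /group_alg_onE xG /group_alg_onE yG; apply/group_alg_onE => l lG.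
rewrite -[x ** y]/(group_mul x y) /group_mul /bisum linear_sum big1 // => i _.
rewrite linear_sum big1 // => j _.
have [iG|iG] := boolP (i \in G); last first.
  by move: (xG i iG) => xi0; rewrite [X in X * _]xi0 mul0r linear0 linear0.
have [jG|jG] := boolP (j \in G); last first.
  by move: (yG j jG) => yj0; rewrite [X in _ * X]yj0 mulr0 linear0 linear0.
rewrite [LHS]mcoeffU; case: eqVneq => // ijl.
by rewrite -ijl rpredD in lG.
Qed.

Definition group_alg_on : algebra k :=
  subalgebra group_alg_on_subspace group_alg_on_mul_closed.

Definition group_comp (l : L) : set group_alg_on :=
  fun x => exists a : k, elt_val x = a *: zpow l.

End GroupAlgebra.

Section GradedCentroid.
Context {k : fieldType} {L : zmodType} (B : graded_algebra k L).

Definition centroid_comp (l : L) : set (centroid B) := fun c =>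
  forall m x, gcomp B m x -> gcomp B (l + m) (centroid_act c x).

Definition central_grading_group : set L := fun l =>
  exists c, centroid_comp l c /\ c <> 0.

Definition graded_ideal (I : set B) : Prop :=
  is_ideal I /\
  forall x, I x -> family_sum (fun l => gcomp B l `&` I)%classic x.

Definition graded_simple : Prop :=
  nonzero_mul B /\
  forall I : set B, graded_ideal I -> I = [set 0]%classic \/ I = setT.

Definition graded_central : Prop :=
  centroid_comp 0 = range (fun a : k => a *: centroid1).

Definition graded_central_simple : Prop := graded_central /\ graded_simple.

(* k[Gamma(B)] presupposes that Gamma(B) is a subgroup of [L], which holds
   when [B] is graded-simple. *)
Definition split_centroid : Prop :=
  exists G : zmodClosed L, [set` G]%classic = central_grading_group /\
    graded_isom centroid_comp (@group_comp k L G).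

End GradedCentroid.

Definition classA (k : fieldType) (M : zmodType) (A : graded_algebra k M) :
  Prop := central_simple A.

Definition classB (k : fieldType) (L : zmodType) (G : zmodClosed L)
    (B : graded_algebra k L) : Prop :=
  [/\ graded_central_simple B, split_centroid B &
      central_grading_group B = [set` G]%classic].

Section Tensor.
Context {k : fieldType} (A : algebra k) (L : zmodType).

Lemma tens_mul_subproof (l m : L) :
  bilinear_for *:%R *:%R
    (fun a b : A => single (l + m) (a ** b) : dirsum A L).
Proof.
split=> [b c a a'|a c b b'] /=.
  by rewrite -linearP /= (linearPl amul).
by rewrite -linearP /= (linearPr amul).
Qed.

Definition tens_mul : dirsum A L -> dirsum A L -> dirsum A L :=
  bisum (fun l m a b => single (l + m) (a ** b)).

(* The algebra A (x) k[L]: since the z^l form a basis of k[L], every element is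
   uniquely a finite sum of terms a_l (x) z^l, and it is encoded by the finitely
   supported function l |-> a_l.  The lemmas [tens_bilinear], [tens_universal]
   and [tensM] show that this is a tensor product of algebras. *)
Definition tens_alg : algebra k :=
  mk_algebra (bisum_bilinear tens_mul_subproof : bilinear_for _ _ tens_mul).

Definition tcoef (l : L) (x : tens_alg) : A := mcoeff l (x : dirsum A L).

Lemma tcoef_linear l : linear (tcoef l).
Proof. by move=> c x y; rewrite /tcoef mcoeffD mcoeffZ. Qed.

HB.instance Definition _ l :=
  GRing.isLinear.Build k tens_alg A *:%R (tcoef l) (tcoef_linear l).

Lemma tens_algP x y : (forall l, tcoef l x = tcoef l y) -> x = y.
Proof. by move=> xy; apply/malgP. Qed.

Definition tens (a : A) (p : group_alg k L) : tens_alg :=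
  \sum_(l <- msupp (p : dirsum k^o L)) single l (gcoef l p *: a).

Lemma tcoef_tens a (p : group_alg k L) l :
  tcoef l (tens a p) = gcoef l p *: a.
Proof.
rewrite [LHS](mcoeff_sumU (msupp _) (fun l => _ *: a)).
by case: ifPn => // /mcoeff_outdom; rewrite /gcoef => ->; rewrite scale0r.
Qed.

Lemma tens_zpow a l : tens a (zpow k l) = single l a.
Proof.
apply: tens_algP => m; rewrite tcoef_tens gcoef_zpow /tcoef mcoeffU.
by case: eqP => _; rewrite ?scale1r ?scale0r.
Qed.

Lemma tens_bilinear : bilinear_for *:%R *:%R tens.
Proof.
split=> [p c a a'|a c p p'] /=; apply: tens_algP => l.
  by rewrite linearP /= !tcoef_tens scalerDr !scalerA mulrC.
by rewrite linearP /= !tcoef_tens linearP /= scalerDl scalerA.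
Qed.

Lemma tens_algE (x : tens_alg) :
  x = \sum_(l <- msupp (x : dirsum A L)) tens (tcoef l x) (zpow k l).
Proof.
rewrite [LHS](dirsumE (x : dirsum A L)); apply: eq_bigr => l _.
by rewrite tens_zpow.
Qed.

Lemma tens_universal (W : lmodType k) (b : A -> group_alg k L -> W) :
  bilinear_for *:%R *:%R b ->
  exists! f : tens_alg -> W, linear f /\ forall a p, f (tens a p) = b a p.
Proof.
move=> bP; pose b' : {bilinear A -> group_alg k L -> W} :=
  HB.pack_for {bilinear A -> group_alg k L -> W} b
  (@bilinear_isBilinear.Build k A (group_alg k L) W *:%R *:%R b bP).
pose f (x : tens_alg) : W :=
  \sum_(l <- msupp (x : dirsum A L)) b' (tcoef l x) (zpow k l).
have fE (D : {fset L}) (x : tens_alg) : (msupp (x : dirsum A L) `<=` D)%fset ->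
    f x = \sum_(l <- D) b' (tcoef l x) (zpow k l).
  move=> xD; apply: big_fset_incl => // l _ /mcoeff_outdom.
  by rewrite /tcoef => ->; rewrite linear0l.
have fl : linear f.
  move=> c x y.
  pose D := (msupp (x : dirsum A L) `|` msupp (y : dirsum A L)
    `|` msupp (c *: x + y : dirsum A L))%fset.
  rewrite (fE D) ?fsubsetUr // (fE D x) ?(fE D y); first last.
  - by rewrite /D -fsetUA fsubsetUl.
  - by rewrite /D (fsetUC (msupp (x : dirsum A L))) -fsetUA fsubsetUl.
  rewrite scaler_sumr -big_split; apply: eq_bigr => l _ /=.
  by rewrite linearP; apply: (linearPl b').
have fz a l : f (tens a (zpow k l)) = b a (zpow k l).
  rewrite (fE [fset l]%fset); last by rewrite tens_zpow msuppU_le.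
  by rewrite big_seq_fset1 tcoef_tens gcoef_zpow eqxx scale1r.
exists f; split=> [|g [gl gb]].
  split=> // a p; move: p; apply: group_alg_ext => //.
    by move=> c p q; rewrite tens_bilinear.2 fl.
  exact: bP.2.
apply/funext => x.
pose g' : {linear tens_alg -> W} := HB.pack_for {linear tens_alg -> W} g
  (GRing.isLinear.Build k tens_alg W *:%R g gl).
rewrite -[RHS]/(g' x) [in RHS](tens_algE x) linear_sum.
by apply: eq_bigr => l _; rewrite -[RHS]/(g _) gb.
Qed.

Lemma tens_single_mul a a' l l' :
  tens a (zpow k l) ** tens a' (zpow k l') = tens (a ** a') (zpow k (l + l')).
Proof.
by rewrite !tens_zpow; apply: (bisum_single tens_mul_subproof).
Qed.

Lemma tensM a a' p p' : tens a p ** tens a' p' = tens (a ** a') (p ** p').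
Proof.
move: p; apply: group_alg_ext => [c p q|c p q|l].
- by rewrite tens_bilinear.2 (linearPl amul).
- by rewrite (linearPl amul) tens_bilinear.2.
move: p'; apply: group_alg_ext => [c p q|c p q|l'].
- by rewrite tens_bilinear.2 (linearPr amul).
- by rewrite (linearPr amul) tens_bilinear.2.
by rewrite tens_single_mul zpowM.
Qed.

End Tensor.

Arguments tens_bilinear {k A L}.

Section Loop.
Context {k : fieldType} {L M : zmodType}.
Variables (pi : {additive L -> M}) (A : graded_algebra k M).

Definition loop_set : set (tens_alg A L) :=
  family_sum (fun l x => exists2 a, gcomp A (pi l) a & x = tens a (zpow k l)).

Let comp_sub m : is_subspace (gcomp A m) := (gcomp_direct A).1 m.

Lemma loop_setE (x : tens_alg A L) :
  loop_set x <-> forall l, gcomp A (pi l) (tcoef l x).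
Proof.
split=> [[s [f [fP ->]]] l|xA].
  rewrite linear_sum big_seq; apply: big_ind => [|u v Au Av|m ms].
  - exact: (comp_sub _).1.
  - by rewrite -[u]scale1r; apply: (comp_sub _).2.
  have [a Aa ->] := fP m ms; rewrite /= tcoef_tens gcoef_zpow.
  case: eqVneq => [<-|_]; first by rewrite scale1r.
  by rewrite scale0r; apply: (comp_sub _).1.
exists (msupp (x : dirsum A L)), (fun l => tens (tcoef l x) (zpow k l)).
by split=> [l _|]; [exists (tcoef l x) | exact: tens_algE].
Qed.

Lemma loop_subspace : is_subspace loop_set.
Proof.
split=> [|c x y /loop_setE xA /loop_setE yA]; apply/loop_setE => l.
  by rewrite linear0; apply: (comp_sub _).1.
by rewrite linearP; apply: (comp_sub _).2.
Qed.

Lemma loop_mul_closed : mul_closed loop_set.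
Proof.
move=> x y /loop_setE xA /loop_setE yA; apply/loop_setE => l.
have sumP (I : eqType) (s : seq I) (F : I -> A) :
    (forall i, gcomp A (pi l) (F i)) -> gcomp A (pi l) (\sum_(i <- s) F i).
  move=> FA; apply: big_ind => [|u v Au Av|//]; first exact: (comp_sub _).1.
  by rewrite -[u]scale1r; apply: (comp_sub _).2.
rewrite -[x ** y]/(tens_mul x y) /tens_mul /bisum linear_sum; apply: (sumP) => i.
rewrite linear_sum; apply: sumP => j; rewrite [X in gcomp _ _ X]mcoeffU.
case: eqVneq => [<-|_]; last exact: (comp_sub _).1.
by rewrite raddfD; apply: gcompM; [apply: xA | apply: yA].
Qed.

Definition loop_base : algebra k := subalgebra loop_subspace loop_mul_closed.

Definition loop_comp (l : L) : set loop_base := fun x =>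
  exists2 a, gcomp A (pi l) a & elt_val x = tens a (zpow k l).

Lemma loop_direct : is_direct_sum loop_comp.
Proof.
split=> [l|x].
  split=> [|c x y [a Aa xa] [b Ab yb]].
    exists 0; first exact: (comp_sub _).1.
    by apply: tens_algP => m; rewrite tcoef_tens scaler0 linear0.
  exists (c *: a + b); first exact: (comp_sub _).2.
  by rewrite tens_bilinear.1 -xa -yb.
have xA := (loop_setE _).1 (subspace_eltP x).
have homS l : loop_set (tens (tcoef l (elt_val x)) (zpow k l)).
  apply/loop_setE => m; rewrite /= tcoef_tens gcoef_zpow.
  case: eqVneq => [<-|_]; first by rewrite scale1r.
  by rewrite scale0r; apply: (comp_sub _).1.
pose h l : loop_base := mk_elt loop_subspace (homS l).
pose f : dirsum loop_base L :=
  \sum_(l <- msupp (elt_val x : dirsum A L)) << h l *g l >>.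
have fE l : f@_l = h l.
  rewrite /f mcoeff_sumU; case: ifPn => // /mcoeff_outdom xl0.
  apply: val_inj; apply: tens_algP => m.
  by rewrite [RHS]tcoef_tens [tcoef l _]xl0 scaler0 [LHS]linear0.
have sumE (g : dirsum loop_base L) m : (forall l, loop_comp l g@_l) ->
    tcoef m (elt_val (\sum_(l <- msupp g) g@_l)) = tcoef m (elt_val g@_m).
  move=> gP.
  have -> : elt_val (\sum_(l <- msupp g) g@_l) = \sum_(l <- msupp g) elt_val g@_l.
    exact: (raddf_sum (val : loop_base -> tens_alg A L)).
  rewrite linear_sum; have [mg|mg] := boolP (m \in msupp g).
    rewrite (big_fsetD1 m) //= big_seq big1 ?addr0 // => l.
    rewrite in_fsetD1 => /andP[lm _]; have [a _ ->] := gP l.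
    by rewrite /= tcoef_tens gcoef_zpow (negPf lm) scale0r.
  rewrite (mcoeff_outdom mg) linear0 big_seq big1 // => l lg.
  have [a _ ->] := gP l; rewrite /= tcoef_tens gcoef_zpow.
  case: eqVneq => [lm|_]; [by rewrite -lm lg in mg | exact: scale0r].
have fP l : loop_comp l f@_l.
  by rewrite fE; exists (tcoef l (elt_val x)).
exists f; split=> [|g [gP xg]].
  split=> //; apply: val_inj; apply: tens_algP => m.
  by rewrite [RHS]sumE // fE [RHS]tcoef_tens gcoef_zpow eqxx scale1r.
apply/malgP => l; apply: val_inj; rewrite fE /=.
have [a Aa ga] := gP l; rewrite ga; congr tens.
rewrite [in LHS]xg sumE // ga tcoef_tens gcoef_zpow eqxx; exact: scale1r.
Qed.

Lemma loop_compM l m (x y : loop_base) :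
  loop_comp l x -> loop_comp m y -> loop_comp (l + m) (x ** y).
Proof.
move=> [a Aa xa] [b Ab yb]; exists (a ** b).
  by rewrite raddfD; apply: gcompM.
by rewrite -[LHS]/(elt_val x ** elt_val y) xa yb tens_single_mul.
Qed.

Definition loop_algebra : graded_algebra k L :=
  GradedAlgebra loop_direct loop_compM.

End Loop.

Section CentralImages.
Context {k : fieldType} {L M : zmodType} (pi : {additive L -> M}).
Context (B : graded_algebra k L).

Definition centroid_hom (rho : {scalar (centroid B)}) : Prop :=
  rho centroid1 = 1 /\ forall c d, rho (c ** d) = rho c * rho d.

Definition specialization (rho : {scalar (centroid B)}) (A : graded_algebra k M)
    (phi : {linear B -> A}) : Prop :=
  [/\ exists x, phi x != 0,
      {morph phi : x y / x ** y},
      forall a, exists x, phi x = a,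
      forall l x, gcomp B l x -> gcomp A (pi l) (phi x) &
      forall c x, phi (centroid_act c x) = rho c *: phi x].

Definition central_image (A : graded_algebra k M) : Prop :=
  exists2 rho : {scalar (centroid B)}, centroid_hom rho &
  exists phi : {linear B -> A}, specialization rho phi.

End CentralImages.

Section HomogeneousComponents.
Context {k : fieldType} {M : zmodType} (A : graded_algebra k M).

Definition decomp (x : A) : dirsum A M :=
  projT1 (cid ((gcomp_direct A).2 x)).

Lemma decomp_comp x m : gcomp A m (decomp x)@_m.
Proof. by rewrite /decomp; case: cid => f [[]]. Qed.

Lemma decompE x : x = \sum_(m <- msupp (decomp x)) (decomp x)@_m.
Proof. by rewrite /decomp; case: cid => f [[]]. Qed.

Lemma decomp_unique x (f : dirsum A M) :
  (forall m, gcomp A m f@_m) -> x = \sum_(m <- msupp f) f@_m -> decomp x = f.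
Proof. by rewrite /decomp; case: cid => g [_ gU] /= fA xf; apply: gU. Qed.

Lemma dsum_subset (f : dirsum A M) (D : {fset M}) : (msupp f `<=` D)%fset ->
  \sum_(m <- msupp f) f@_m = \sum_(m <- D) f@_m.
Proof. by move=> fD; apply: big_fset_incl => // m _ /mcoeff_outdom. Qed.

Lemma decomp_linear : linear decomp.
Proof.
move=> c x y; apply: decomp_unique => [m|].
  by rewrite mcoeffD mcoeffZ; apply: ((gcomp_direct A).1 m).2;
    apply: decomp_comp.
rewrite [in LHS](decompE x) [in LHS](decompE y).
set D := (msupp (decomp x) `|` msupp (decomp y)
  `|` msupp (c *: decomp x + decomp y))%fset.
rewrite (@dsum_subset (decomp x) D); last by rewrite /D -fsetUA fsubsetUl.
rewrite (@dsum_subset (decomp y) D); last first.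
  by rewrite /D (fsetUC (msupp (decomp x))) -fsetUA fsubsetUl.
rewrite (@dsum_subset (_ + _) D); last by rewrite fsubsetUr.
rewrite scaler_sumr -big_split; apply: eq_bigr => m _ /=.
by rewrite mcoeffD mcoeffZ.
Qed.

Lemma decomp_homog m x : gcomp A m x -> decomp x = single m x.
Proof.
move=> Ax; apply: decomp_unique => [m'|].
  rewrite mcoeffU; case: eqVneq => [<-//|_]; exact: ((gcomp_direct A).1 m').1.
by rewrite (dsum_subset msuppU_le) big_seq_fset1 mcoeffUU.
Qed.

End HomogeneousComponents.

Section Twist.
Context {k : fieldType} {L M : zmodType}.
Variables (xi : M -> L) (chi : L -> k) (A : graded_algebra k M).

Definition twist_mul (u v : A) : A :=
  bisum (fun l m (a b : A) => chi (xi l + xi m - xi (l + m)) *: (a ** b))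
    (decomp u) (decomp v).

Lemma twist_mul_subproof (l m : M) : bilinear_for *:%R *:%R
  (fun a b : A => chi (xi l + xi m - xi (l + m)) *: (a ** b)).
Proof.
split=> [b c a a'|a c b b'] /=.
  by rewrite (linearPl amul) scalerDr !scalerA mulrC.
by rewrite (linearPr amul) scalerDr !scalerA mulrC.
Qed.

Lemma twist_mul_bilinear : bilinear_for *:%R *:%R twist_mul.
Proof.
split=> [v c u u'|u c v v']; rewrite /twist_mul decomp_linear.
  exact: (bisum_bilinear twist_mul_subproof).1.
exact: (bisum_bilinear twist_mul_subproof).2.
Qed.

Lemma twist_mul_homog l m u v : gcomp A l u -> gcomp A m v ->
  twist_mul u v = chi (xi l + xi m - xi (l + m)) *: (u ** v).
Proof.
move=> Au Av; rewrite /twist_mul (decomp_homog Au) (decomp_homog Av).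
exact: (bisum_single twist_mul_subproof).
Qed.

Definition twist_base : algebra k := mk_algebra twist_mul_bilinear.

Lemma twist_compM l m (u v : twist_base) :
  gcomp A l u -> gcomp A m v -> gcomp A (l + m) (u ** v).
Proof.
move=> Au Av; rewrite -[u ** v]/(twist_mul u v) (twist_mul_homog Au Av).
have [A0 AP] := (gcomp_direct A).1 (l + m).
by rewrite -[_ *: _]addr0; apply: AP => //; apply: gcompM.
Qed.

(* The twist A_chi; [chi] matters only on the kernel of the projection of
   which [xi] is a section. *)
Definition twist : graded_algebra k M :=
  @GradedAlgebra k M twist_base (gcomp A) (gcomp_direct A) twist_compM.

End Twist.

(* [chi] restricts to a homomorphism from [G] to the multiplicative group of
   [k]; its values outside [G] are unconstrained. *)
Definition character_on (k : fieldType) (L : zmodType) (G : zmodClosed L)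
    (chi : L -> k) : Prop :=
  (forall g, g \in G -> chi g != 0) /\
  {in G &, {morph chi : g h / g + h >-> g * h}}.

Definition twist_similar (k : fieldType) (L M : zmodType) (G : zmodClosed L)
    (xi : M -> L) (A A' : graded_algebra k M) : Prop :=
  exists2 chi : L -> k, character_on G chi & giso A' (twist xi chi A).

(* Main.v *)
Require Import Defs.
From HB Require Import structures.
From mathcomp Require Import all_boot all_algebra sesquilinear.
From mathcomp Require Import finmap boolp classical_sets functions.
From mathcomp.multinomials Require Import monalg.

(* A graded isomorphism of [B] with the loop algebra of [A] amounts to a
   homomorphism [phi : B -> A] mapping each [B^l] bijectively onto [A^(pi l)]
   (a loop cover), so all four parts are statements about loop covers.  If [A] is
   central-simple, then every element of the centroid of [B] acts on [A] through
   [phi] by a scalar, and lifting the identity of [A] to degree [g] in [G] gives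
   invertible shifts of [B] in the centroid; these span the centroid, and they
   reduce graded ideals of [B] to ideals of [A].  Conversely, if [B] is
   graded-central-simple with split centroid, a homogeneous element of the
   centroid of [A] lifts to [B], so it is a scalar; a minimal-support argument
   then upgrades graded simplicity of [A] to simplicity. *)

Set Implicit Arguments.
Unset Strict Implicit.
Unset Printing Implicit Defensive.

Import GRing.Theory.
Local Open Scope ring_scope.

(** The map [phi] of a loop cover is injective on each component but in general not globally:
    degrees congruent modulo [G] are folded together, and the kernel need not be graded. Hence
    graded ideals of [A] are pulled back component by component, and an equation in [B] is proved by
    applying [phi] to two homogeneous elements of the same degree. A second obstacle is that an
    element of a centroid need not be a finite sum of homogeneous ones. Each of its components is
    nevertheless in the centroid, which is enough to show that it is a scalar; where finiteness is
    required, it is read off from the action on a single nonzero homogeneous vector. For existence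
    in (ii), [A] is not formed as a quotient of [B] but cut out of it as a retract on one component
    per class modulo [G], so that its grading is inherited from [B]. In (iii), two covers of the
    same algebra give two characters of its centroid, and comparing them on the shifts yields the
    twisting character. *)

Definition mk_linear (k : fieldType) (U V : lmodType k) (f : U -> V)
    (fl : linear f) : {linear U -> V} :=
  HB.pack_for {linear U -> V} f (GRing.isLinear.Build k U V *:%R f fl).

Lemma exists_choice (X Y : Type) (P : X -> Y -> Prop) :
  (forall x, exists y, P x y) -> exists f : X -> Y, forall x, P x (f x).
Proof. by move=> /choice [f fP]; exists f. Qed.

(** * Closure properties of subspaces and bilinearity of the product *)

Section Generalities.
Context {k : fieldType}.

Lemma subspaceD (V : lmodType k) (S : set V) x y :
  is_subspace S -> S x -> S y -> S (x + y).
Proof. by case=> _ SP Sx Sy; rewrite -[x]scale1r; apply: SP. Qed.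

Lemma subspaceZ (V : lmodType k) (S : set V) c x :
  is_subspace S -> S x -> S (c *: x).
Proof. by case=> S0 SP Sx; rewrite -[_ *: _]addr0; apply: SP. Qed.

Lemma subspaceB (V : lmodType k) (S : set V) x y :
  is_subspace S -> S x -> S y -> S (x - y).
Proof. by case=> _ SP Sx Sy; rewrite addrC -scaleN1r; apply: SP. Qed.

Lemma subspace_sum (V : lmodType k) (S : set V) (I : Type) (s : seq I) (P : pred I)
    (F : I -> V) :
  is_subspace S -> (forall i, P i -> S (F i)) -> S (\sum_(i <- s | P i) F i).
Proof.
move=> hS FS; apply: (big_ind S) => //; first exact: hS.1.
by move=> x y; apply: subspaceD.
Qed.

Variable A : algebra k.
Implicit Types x y z : A.

Lemma amul0l x : 0 ** x = 0. Proof. exact: linear0l. Qed.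
Lemma amul0r x : x ** 0 = 0. Proof. exact: linear0r. Qed.
Lemma amulDl x y z : (x + y) ** z = x ** z + y ** z. Proof. exact: linearDl. Qed.
Lemma amulDr x y z : z ** (x + y) = z ** x + z ** y. Proof. exact: linearDr. Qed.
Lemma amulZl c x y : (c *: x) ** y = c *: (x ** y). Proof. exact: linearZl_LR. Qed.
Lemma amulZr c x y : y ** (c *: x) = c *: (y ** x). Proof. exact: linearZr_LR. Qed.
Lemma amulBl x y z : (x - y) ** z = x ** z - y ** z. Proof. exact: linearBl. Qed.
Lemma amulBr x y z : z ** (x - y) = z ** x - z ** y. Proof. exact: linearBr. Qed.

End Generalities.

(** * The centroid described by its action on elements *)

Section CentroidElementwise.
Context {k : fieldType} (A : algebra k).
Implicit Types x y z : A.

Definition centroidal (c : A -> A) : Prop :=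
  [/\ linear c, forall x y, c (x ** y) = c x ** y &
      forall x y, c (x ** y) = x ** c y].

(** Commuting with the multiplications by single elements suffices, because the commutant of [c] is
    itself a unital subalgebra. *)
Lemma centroid_setP (c : endo_alg A) :
  centroid_set A c <-> centroidal (endo_fun c).
Proof.
split=> [cP|[_ cl cr] m].
  split=> [|x y|x y]; first exact: endoP.
    have /cP /(congr1 (fun h : endo_alg A => endo_fun h x)) // : mult_alg A (rmult y).
    by move=> S [_ SP]; apply: SP; exists y; right.
  have /cP /(congr1 (fun h : endo_alg A => endo_fun h y)) // : mult_alg A (lmult x).
  by move=> S [_ SP]; apply: SP; exists x; left.
move/(_ (fun m : endo_alg A => c ** m = m ** c)).
apply; split=> [|f [b [->|->]]]; last 2 first.
- by apply: val_inj; apply/funext => x; apply: cr.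
- by apply: val_inj; apply/funext => x; apply: cl.
split; first by split; [rewrite amul0l amul0r | move=> a f g cf cg; rewrite
  amulDr amulDl amulZl amulZr cf cg].
  by apply: val_inj.
move=> f g cf cg; apply: val_inj; apply/funext => x.
move: cf => /(congr1 (fun h : endo_alg A => endo_fun h (endo_fun g x))) /= cf.
move: cg => /(congr1 (fun h : endo_alg A => endo_fun h x)) /= cg.
by apply: (etrans cf); apply: (congr1 (endo_fun f)).
Qed.

Lemma centroid_actP (c : centroid A) : centroidal (centroid_act c).
Proof. exact/centroid_setP/(subspace_eltP c). Qed.

HB.instance Definition _ (c : centroid A) :=
  GRing.isLinear.Build k A A *:%R (centroid_act c)
    (let: And3 cl _ _ := centroid_actP c in cl).

Definition mk_centroid (c : A -> A) (cP : centroidal c) : centroid A :=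
  let: And3 cl _ _ := cP in
  mk_elt (centroid_subspace A)
    ((centroid_setP (mk_endo cl)).2 cP).

Lemma mk_centroidE c (cP : centroidal c) : centroid_act (mk_centroid cP) = c.
Proof. by case: cP. Qed.

Lemma centroid_eq (c d : centroid A) : centroid_act c =1 centroid_act d -> c = d.
Proof. by move=> cd; do 2!apply: val_inj; apply/funext. Qed.

Lemma centroid_actM (c d : centroid A) x :
  centroid_act (c ** d) x = centroid_act c (centroid_act d x).
Proof. by []. Qed.

Lemma centroid_actPl a (c d : centroid A) x :
  centroid_act (a *: c + d) x = a *: centroid_act c x + centroid_act d x.
Proof. by []. Qed.

End CentroidElementwise.

(** * Homogeneous components, and linear maps defined degree by degree *)

Section Components.
Context {k : fieldType} {M : zmodType} (A : graded_algebra k M).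
Implicit Types x y : A.

Lemma gcomp_subspace l : is_subspace (gcomp A l).
Proof. exact: (gcomp_direct A).1. Qed.

Definition hc (l : M) x : A := mcoeff l (decomp x).

Lemma hc_linear l : linear (hc l).
Proof. by move=> c x y; rewrite /hc decomp_linear mcoeffD Defs.mcoeffZ. Qed.

HB.instance Definition _ l :=
  GRing.isLinear.Build k A A *:%R (hc l) (hc_linear l).

Lemma hc_gcomp l x : gcomp A l (hc l x). Proof. exact: decomp_comp. Qed.

Lemma hc_homog l m x : gcomp A l x -> hc m x = if l == m then x else 0.
Proof.
by move=> xl; rewrite /hc (decomp_homog xl) mcoeffU; case: eqVneq.
Qed.

Lemma hc_id l x : gcomp A l x -> hc l x = x.
Proof. by move=> xl; rewrite (hc_homog _ xl) eqxx. Qed.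

Lemma hc_inj x y : (forall l, hc l x = hc l y) -> x = y.
Proof.
move=> xy; rewrite [x]decompE [y]decompE; have -> // : decomp x = decomp y.
exact/malgP.
Qed.

Lemma homog_ind (P : A -> Prop) :
  P 0 -> (forall x y, P x -> P y -> P (x + y)) ->
  (forall l x, gcomp A l x -> P x) -> forall x, P x.
Proof.
move=> P0 PD Ph x; rewrite [x]decompE; apply: big_ind => // l _.
exact: Ph (hc_gcomp l x).
Qed.

Lemma homog_ind2 (P : A -> A -> Prop) :
  (forall x, P x 0) -> (forall y, P 0 y) ->
  (forall x y z, P x y -> P x z -> P x (y + z)) ->
  (forall x y z, P x z -> P y z -> P (x + y) z) ->
  (forall l m x y, gcomp A l x -> gcomp A m y -> P x y) -> forall x y, P x y.
Proof.
move=> P0r P0l PDr PDl Ph; apply: homog_ind => // [x y Px Py z|l x xl].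
  exact: PDl.
by apply: homog_ind => // [y z|m y ym]; [exact: PDr | exact: Ph xl ym].
Qed.

Lemma exists_homog x : x != 0 -> exists l, hc l x != 0.
Proof.
move=> x0; apply: contrapT => h; case/eqP: x0; apply: hc_inj => l.
by rewrite linear0; apply: contrapT => /eqP xl; apply: h; exists l.
Qed.

(** Translation of degrees by [m] is injective, so no other component of [x] contributes. *)
Lemma hc_mulr l m x y : gcomp A m y -> hc (l + m) (x ** y) = hc l x ** y.
Proof.
move=> ym; move: x; apply: homog_ind => [|x x' IH IH'|n x xn].
- by rewrite amul0l !linear0 amul0l.
- by rewrite amulDl !linearD /= IH IH' amulDl.
rewrite (hc_homog _ xn) (hc_homog _ (gcompM xn ym)) (inj_eq (addIr m)).
by case: eqP; rewrite // amul0l.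
Qed.

Lemma hc_mull l m x y : gcomp A m y -> hc (m + l) (y ** x) = y ** hc l x.
Proof.
move=> ym; move: x; apply: homog_ind => [|x x' IH IH'|n x xn].
- by rewrite amul0r !linear0.
- by rewrite amulDr !linearD /= IH IH'.
rewrite (hc_homog _ xn) (hc_homog _ (gcompM ym xn)) (inj_eq (addrI m)).
by case: eqP; rewrite // amul0r.
Qed.

Section Gluing.
Variables (W : lmodType k) (f : M -> A -> W).

(** Linearity is asked only on a subset because the functions to be glued, such as lifts through a
    cover, are made by choice and carry no information off one component. *)
Definition linear_on (S : set A) (g : A -> W) : Prop :=
  forall c x y, S x -> S y -> g (c *: x + y) = c *: g x + g y.

Hypothesis fP : forall l, linear_on (gcomp A l) (f l).

Let f0 l : f l 0 = 0.
Proof.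
have S0 := (gcomp_subspace l).1.
by have := fP (-1) S0 S0; rewrite scaler0 addr0 scaleN1r addNr.
Qed.

Definition gluing_fun x : W := \sum_(l <- msupp (decomp x)) f l (hc l x).

Let gluing_funE (D : {fset M}) x : (msupp (decomp x) `<=` D)%fset ->
  gluing_fun x = \sum_(l <- D) f l (hc l x).
Proof.
move=> xD; apply: big_fset_incl => // l _ /mcoeff_outdom.
by rewrite /hc => ->.
Qed.

Lemma gluing_linear : linear gluing_fun.
Proof.
move=> c x y.
pose D := (msupp (decomp x) `|` msupp (decomp y)
    `|` msupp (decomp (c *: x + y)))%fset.
rewrite (gluing_funE (D := D)) ?fsubsetUr // (gluing_funE (D := D) (x := x)).
  rewrite (gluing_funE (D := D) (x := y)).
    rewrite scaler_sumr -big_split /=; apply: eq_bigr => l _.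
    by rewrite linearP fP //; apply: hc_gcomp.
  by rewrite /D (fsetUC (msupp (decomp x))) -fsetUA fsubsetUl.
by rewrite /D -fsetUA fsubsetUl.
Qed.

Definition gluing : {linear A -> W} := mk_linear gluing_linear.

Lemma gluingE l x : gcomp A l x -> gluing x = f l x.
Proof.
move=> xl; rewrite -[LHS]/(gluing_fun x) (gluing_funE (D := [fset l]%fset)).
  by rewrite big_seq_fset1 hc_id.
by rewrite (decomp_homog xl) msuppU_le.
Qed.

End Gluing.

Lemma eq_linear_homog (W : lmodType k) (f g : {linear A -> W}) :
  (forall l x, gcomp A l x -> f x = g x) -> f =1 g.
Proof.
move=> fg; apply: homog_ind => [|x y fx fy|//]; first by rewrite !linear0.
by rewrite !linearD fx fy.
Qed.

Lemma linear_scale_on (W : lmodType k) (f : {linear A -> W}) (S : set A) :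
  linear_on S f.
Proof. by move=> c x y _ _; rewrite linearP. Qed.

Lemma morph_homog (A' : algebra k) (f : {linear A -> A'}) :
  (forall l m x y, gcomp A l x -> gcomp A m y -> f (x ** y) = f x ** f y) ->
  {morph f : x y / x ** y}.
Proof.
move=> fM; apply: homog_ind2 => // [x|y|x y z fy fz|x y z fx fy].
- by rewrite amul0r linear0 amul0r.
- by rewrite amul0l linear0 amul0l.
- by rewrite amulDr !(linearD f) fy fz amulDr.
by rewrite amulDl !(linearD f) fx fy amulDl.
Qed.

Lemma centroidal_homog (c : {linear A -> A}) :
  (forall l m x y, gcomp A l x -> gcomp A m y -> c (x ** y) = c x ** y) ->
  (forall l m x y, gcomp A l x -> gcomp A m y -> c (x ** y) = x ** c y) ->
  centroidal c.
Proof.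
move=> cl cr; split; first exact: linearP.
  apply: homog_ind2 => // [x|y|x y z fy fz|x y z fx fy].
  - by rewrite !amul0r (linear0 c).
  - by rewrite (linear0 c) !amul0l linear0.
  - by rewrite !amulDr (linearD c) fy fz.
  by rewrite amulDl !(linearD c) fx fy amulDl.
apply: homog_ind2 => // [x|y|x y z fy fz|x y z fx fy].
- by rewrite (linear0 c) !amul0r (linear0 c).
- by rewrite !amul0l (linear0 c).
- by rewrite amulDr !(linearD c) fy fz amulDr.
by rewrite !amulDl (linearD c) fx fy.
Qed.

Lemma gcomp_disjoint l m x : gcomp A l x -> gcomp A m x -> l != m -> x = 0.
Proof. by move=> xl xm; rewrite -(hc_id xm) (hc_homog _ xl) => /negPf ->. Qed.

(* Infinitely many of these components of [c] may be nonzero, unless the algebra is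
   graded-simple. *)
Lemma centroid_component (c : A -> A) (d : M) : centroidal c ->
  exists2 cd : A -> A, centroidal cd &
    forall l x, gcomp A l x -> cd x = hc (d + l) (c x).
Proof.
move=> [cl cMl cMr].
have fP l : linear_on (gcomp A l) (fun x => hc (d + l) (c x)).
  by move=> a x y _ _; rewrite cl linearP.
exists (gluing fP) => [|l x xl]; last by rewrite (gluingE fP xl).
apply: centroidal_homog => l m x y xl ym.
  by rewrite (gluingE fP (gcompM xl ym)) (gluingE fP xl) cMl addrA hc_mulr.
by rewrite (gluingE fP (gcompM xl ym)) (gluingE fP ym) cMr addrCA hc_mull.
Qed.

Lemma graded_ideal_hc (I : set A) x l : graded_ideal I -> I x -> I (hc l x).
Proof.
move=> [[hI _] IP] /IP [s [f [fP ->]]]; rewrite linear_sum /= big_seq.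
apply: subspace_sum => // m /fP [fm If]; rewrite (hc_homog _ fm).
by case: eqP => // _; apply: hI.1.
Qed.

Lemma graded_idealP (I : set A) : is_subspace I ->
  (forall x l, I x -> I (hc l x)) ->
  (forall l m b x, gcomp A l b -> gcomp A m x -> I x -> I (b ** x) /\ I (x ** b)) ->
  graded_ideal I.
Proof.
move=> hI Ihc IM; split; first split=> // b x Ix.
  suff h m : I (b ** hc m x) /\ I (hc m x ** b).
    rewrite [x]decompE; elim/big_ind: _ => [||m _]; last exact: h.
      by rewrite amul0l amul0r; split; apply: hI.1.
    by move=> u v [? ?] [? ?]; rewrite amulDl amulDr; split; apply: subspaceD.
  move: b; apply: homog_ind => [|b b' [? ?] [? ?]|l b bl].
  - by rewrite amul0l amul0r; split; apply: hI.1.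
  - by rewrite amulDl amulDr; split; apply: subspaceD.
  by apply: (IM l m) => //; [exact: hc_gcomp | exact: Ihc].
move=> x Ix; exists (msupp (decomp x)), (fun l => hc l x); split.
  by move=> l _; split; [exact: hc_gcomp | exact: Ihc].
exact: decompE.
Qed.

End Components.

(** * Graded isomorphisms *)

Section GradedIsomorphisms.
Context {k : fieldType} {L : zmodType}.

Lemma giso_intro (A A' : graded_algebra k L) (f : {linear A -> A'}) (g : A' -> A) :
  cancel f g -> cancel g f -> {morph f : x y / x ** y} ->
  (forall l x, gcomp A l x -> gcomp A' l (f x)) ->
  (forall l x, gcomp A' l x -> gcomp A l (g x)) -> giso A A'.
Proof.
move=> fK gK fM fl gl; exists f; split=> [||l] //; first by exists g.
apply/seteqP; split=> [_ [x xl <-]|y yl]; first exact: fl.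
by exists (g y); [exact: gl | exact: gK].
Qed.

Lemma giso_sym (A A' : graded_algebra k L) : giso A A' -> giso A' A.
Proof.
case=> f [[g fK gK] fM fl].
have glin : linear g by move=> c x y; apply: (can_inj fK); rewrite linearP !gK.
apply: (@giso_intro _ _ (mk_linear glin) f) => // [x y|l x|l x xl].
- by apply: (can_inj fK); rewrite fM !gK.
- by rewrite -fl => -[z zl <-]; rewrite /= fK.
by rewrite -fl; exists x.
Qed.

End GradedIsomorphisms.

(** * Loop covers and their equivalence with loop algebras *)

Section LoopCovers.
Context {k : fieldType} {L M : zmodType} (pi : {additive L -> M}).

(* An epimorphism of this kind makes [B] isomorphic to the loop algebra of [A]
   (lemma [loop_coverP]). *)
Definition loop_cover (B : graded_algebra k L) (A : graded_algebra k M)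
    (phi : {linear B -> A}) : Prop :=
  [/\ {morph phi : x y / x ** y},
      forall l x, gcomp B l x -> gcomp A (pi l) (phi x),
      forall l x, gcomp B l x -> phi x = 0 -> x = 0 &
      forall l a, gcomp A (pi l) a -> exists2 x, gcomp B l x & phi x = a].

Section Lifts.
Context (B : graded_algebra k L) (A : graded_algebra k M) (phi : {linear B -> A}).
Hypothesis cov : loop_cover phi.

(** The inverse of the bijection that [phi] induces from B^l onto A^(pi l), with default value 0
    elsewhere. *)
Definition cover_lift (l : L) (a : A) : B :=
  xget 0 [set x | gcomp B l x /\ phi x = a]%classic.

Lemma cover_liftP l a : gcomp A (pi l) a ->
  gcomp B l (cover_lift l a) /\ phi (cover_lift l a) = a.
Proof.
case: cov => _ _ _ sur /sur [x xl xa]; rewrite /cover_lift.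
by case: xgetP => // /(_ x); case.
Qed.

Lemma cover_inj l x y : gcomp B l x -> gcomp B l y -> phi x = phi y -> x = y.
Proof.
case: cov => _ _ inj _ xl yl xy; apply/eqP; rewrite -subr_eq0; apply/eqP.
by apply: (inj l); [exact: subspaceB (gcomp_subspace B l) xl yl | rewrite
  linearB xy subrr].
Qed.

Lemma cover_liftK l x : gcomp B l x -> cover_lift l (phi x) = x.
Proof.
case: (cov) => _ phil _ _ xl; have [ll] := cover_liftP (phil _ _ xl).
exact: cover_inj ll xl.
Qed.

Lemma cover_lift_linear l : linear_on (gcomp A (pi l)) (cover_lift l).
Proof.
move=> c a b Aa Ab; have [ac ap] := cover_liftP Aa; have [bc bp] := cover_liftP Ab.
have -> : c *: a + b = phi (c *: cover_lift l a + cover_lift l b) by rewrite linearP ap bp.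
by rewrite cover_liftK //; apply: (gcomp_subspace B l).2.
Qed.

Lemma cover_surj : (forall m, exists l, pi l = m) -> forall a, exists x, phi x = a.
Proof.
case: cov => _ _ _ sur pi_surj; apply: homog_ind => [|a b [x <-] [y <-]|m a].
- by exists 0; rewrite linear0.
- by exists (x + y); rewrite linearD.
by have [l <-] := pi_surj m; move=> /sur [x _ <-]; exists x.
Qed.

End Lifts.

Section Transfer.
Context (B B' : graded_algebra k L) (A : graded_algebra k M).
Context (phi : {linear B -> A}) (phi' : {linear B' -> A}).
Hypotheses (cov : loop_cover phi) (cov' : loop_cover phi').
Variables (g : L) (c : {linear A -> A}).
Hypothesis cg : forall m a, gcomp A m a -> gcomp A (pi g + m) (c a).

Let phil l x : gcomp B l x -> gcomp A (pi (g + l)) (c (phi x)).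
Proof. by case: cov => _ phil _ _ xl; rewrite raddfD; apply/cg/phil. Qed.

Let fP l : linear_on (gcomp B l) (fun x => cover_lift phi' (g + l) (c (phi x))).
Proof.
by move=> s x y xl yl; rewrite !linearP (cover_lift_linear cov') //; apply: phil.
Qed.

(** Conjugates [c] by the two covers; [g] is a chosen preimage of the degree of [c]. With [g] = 0
    and [c] the identity it identifies two covers of [A]; with [B] = [B'] and [c] in the centroid of
    [A] it lifts [c] to the centroid of [B]. *)
Definition transfer : {linear B -> B'} := gluing fP.

Let transferP l x : gcomp B l x ->
  gcomp B' (g + l) (transfer x) /\ phi' (transfer x) = c (phi x).
Proof.
by move=> xl; rewrite /transfer (gluingE _ xl); apply/(cover_liftP cov')/phil.
Qed.

Lemma transfer_gcomp l x : gcomp B l x -> gcomp B' (g + l) (transfer x).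
Proof. by case/transferP. Qed.

Lemma transferE x : phi' (transfer x) = c (phi x).
Proof.
move: x; apply: homog_ind => [|x y hx hy|l x xl]; first by rewrite !linear0.
  by rewrite !linearD /= hx hy.
by case: (transferP xl).
Qed.

End Transfer.

Lemma cover_giso (B B' : graded_algebra k L) (A : graded_algebra k M)
    (phi : {linear B -> A}) (phi' : {linear B' -> A}) :
  loop_cover phi -> loop_cover phi' -> giso B B'.
Proof.
move=> cov cov'.
have idP m a : gcomp A m a -> gcomp A (pi 0 + m) (idfun a).
  by rewrite raddf0 add0r.
pose f := transfer cov cov' idP; pose f' := transfer cov' cov idP.
have fl l x : gcomp B l x -> gcomp B' l (f x).
  by move=> xl; rewrite -[l]add0r; apply: transfer_gcomp.
have fl' l x : gcomp B' l x -> gcomp B l (f' x).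
  by move=> xl; rewrite -[l]add0r; apply: transfer_gcomp.
apply: (@giso_intro _ _ _ _ f f') => //.
- apply: homog_ind => [|x y hx hy|l x xl]; first by rewrite !linear0.
    by rewrite !linearD hx hy.
  by apply: (cover_inj cov (fl' _ _ (fl _ _ xl)) xl); rewrite !transferE.
- apply: homog_ind => [|x y hx hy|l x xl]; first by rewrite !linear0.
    by rewrite !linearD hx hy.
  by apply: (cover_inj cov' (fl _ _ (fl' _ _ xl)) xl); rewrite !transferE.
apply: morph_homog => l m x y xl ym.
apply: (cover_inj cov' (fl _ _ (gcompM xl ym)) (gcompM (fl _ _ xl) (fl _ _ ym))).
by case: (cov) (cov') => phiM _ _ _ [phiM' _ _ _]; rewrite phiM' !transferE phiM.
Qed.

Lemma loop_cover_giso (B B' : graded_algebra k L) (A : graded_algebra k M)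
    (phi : {linear B -> A}) :
  loop_cover phi -> giso B' B -> exists psi : {linear B' -> A}, loop_cover psi.
Proof.
case=> phiM phil inj sur [f [fbij fM fE]].
have fl l x : gcomp B' l x -> gcomp B l (f x) by move=> xl; rewrite -fE; exists x.
have clin : linear (phi \o f) by move=> c x y /=; rewrite !linearP.
exists (mk_linear clin); split=> [x y|l x xl|l x xl /= p0|l a al] /=.
- by rewrite fM phiM.
- exact/phil/fl.
- by apply: (bij_inj fbij); rewrite linear0; exact: inj (fl _ _ xl) p0.
have [y] := sur _ _ al; rewrite -fE => -[x xl <-] ya; by exists x.
Qed.

Lemma cover_loop_giso (B : graded_algebra k L) (A A' : graded_algebra k M)
    (phi : {linear B -> A}) :
  loop_cover phi -> giso A A' -> exists psi : {linear B -> A'}, loop_cover psi.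
Proof.
case=> phiM phil inj sur [f [fbij fM fE]].
have clin : linear (f \o phi) by move=> c x y /=; rewrite !linearP.
exists (mk_linear clin); split=> [x y|l x xl|l x xl /= p0|l a] /=.
- by rewrite phiM fM.
- by rewrite -fE; exists (phi x) => //; apply: phil.
- by apply: inj xl _; apply: (bij_inj fbij); rewrite linear0.
by rewrite -fE => -[b /sur [x xl <-] <-]; exists x.
Qed.

(** The cover puts every z^l equal to 1: it sends a (x) z^l to a. *)
Lemma loop_algebra_cover (A : graded_algebra k M) :
  exists phi : {linear loop_algebra pi A -> A}, loop_cover phi.
Proof.
have fP l : linear_on (gcomp (loop_algebra pi A) l)
    (fun x : loop_base pi A => tcoef l (elt_val x)).
  by move=> c x y _ _; apply: (linearP (tcoef l)).
pose phi : {linear loop_algebra pi A -> A} := gluing fP.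
have phiE l (x : loop_algebra pi A) a : gcomp (loop_algebra pi A) l x ->
    elt_val x = tens a (zpow k l) -> phi x = a.
  by move=> xl xE; rewrite /phi (gluingE _ xl) xE tcoef_tens gcoef_zpow eqxx scale1r.
exists phi; split.
- apply: morph_homog => l m x y xl ym.
  have [a Aa xa] := xl; have [b Ab yb] := ym.
  rewrite (phiE _ _ _ xl xa) (phiE _ _ _ ym yb).
  apply: (phiE _ _ _ (gcompM xl ym)).
  by rewrite -[LHS]/(elt_val x ** elt_val y) xa yb tens_single_mul.
- by move=> l x xl; have [a Aa xa] := xl; rewrite (phiE _ _ _ xl xa).
- move=> l x xl; have [a Aa xa] := xl; rewrite (phiE _ _ _ xl xa) => a0.
  by apply: val_inj; rewrite /= xa a0; apply: (linear0l (HB.pack_for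
    {bilinear A -> group_alg k L -> tens_alg A L} (@tens k A L)
    (@bilinear_isBilinear.Build k A (group_alg k L) (tens_alg A L) *:%R *:%R
      (@tens k A L) tens_bilinear))).
move=> l a Aa.
have aS : loop_set pi (tens a (zpow k l)).
  by exists [:: l], (fun l => tens a (zpow k l)); rewrite big_seq1; split=> // m;
    rewrite inE => /eqP ->; exists a.
exists (mk_elt (loop_subspace pi A) aS : loop_algebra pi A); first by exists a.
by apply: (phiE l) => //; exists a.
Qed.

Lemma loop_coverP (A : graded_algebra k M) (B : graded_algebra k L) :
  giso (loop_algebra pi A) B <->
  exists phi : {linear B -> A}, loop_cover phi.
Proof.
have [can canP] := loop_algebra_cover A; split=> [/giso_sym BA|[phi phiP]].
  exact: loop_cover_giso canP BA.
exact: cover_giso canP phiP.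
Qed.

End LoopCovers.

(** * Central-simple algebras and their epimorphic preimages *)

Section CentralSimple.
Context {k : fieldType}.

(** The two-sided annihilator is an ideal, and it is proper because some product is nonzero. *)
Lemma simple_annihilator (A : algebra k) (u : A) : simple_alg A ->
  (forall a, u ** a = 0) -> (forall a, a ** u = 0) -> u = 0.
Proof.
move=> [[x [y xy]] simA] ul ur.
pose I : set A := fun v => (forall a, v ** a = 0) /\ (forall a, a ** v = 0).
have hI : is_ideal I.
  split; first split=> [|c v w [vl vr] [wl wr]].
  - by split=> a; rewrite ?amul0l ?amul0r.
  - by split=> a; rewrite ?amulDl ?amulDr ?amulZl ?amulZr ?vl ?vr ?wl ?wr
      scaler0 addr0.
  by move=> b v [vl vr]; rewrite vl vr; split; split=> a; rewrite ?amul0l ?amul0r.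
have Iu : I u by [].
have [I0|IT] := simA I hI; first by move: Iu; rewrite I0.
have [/(_ y) xy0 _] : I x by rewrite IT.
by rewrite xy0 eqxx in xy.
Qed.

Lemma central_algP (A : algebra k) : central_alg A <->
  forall c : A -> A, centroidal c -> exists s, forall x, c x = s *: x.
Proof.
split=> [cen c cP|cen].
  have cS := subspace_eltP (mk_centroid cP).
  have [s _ sE] : range (fun a : k => a *: endo1 A) (elt_val (mk_centroid cP)).
    by rewrite -cen.
  exists s => x; rewrite -[in LHS](mk_centroidE cP) /centroid_act /centroid_endo.
  by rewrite -sE.
apply/seteqP; split=> [c /centroid_setP /cen [s sE]|_ [s _ <-]].
  exists s => //; apply: val_inj; apply/funext => x.
  by rewrite -[RHS]/(endo_fun c x) sE.
by apply: subspaceZ (centroid_subspace A) _; apply: centroid1_subproof.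
Qed.

(* [phi (c x)] depends only on [phi x], because
   [phi (c x) ** phi y = phi x ** phi (c y)] and A has no annihilator. *)
Lemma centroid_scalar (B A : algebra k) (phi : {linear B -> A}) (c : B -> B) :
  central_simple A -> {morph phi : x y / x ** y} ->
  (forall a, exists x, phi x = a) -> centroidal c ->
  exists s, forall x, phi (c x) = s *: phi x.
Proof.
move=> [/central_algP cenA simA] phiM phi_surj [cl cMl cMr].
have [r rK] := choice phi_surj.
have wd x y : phi x = phi y -> phi (c x) = phi (c y).
  move=> xy; apply/eqP; rewrite -subr_eq0; apply/eqP.
  apply: simple_annihilator => // a; rewrite -[a]rK.
    by rewrite amulBl -!phiM -!cMl !cMr !phiM xy subrr.
  by rewrite amulBr -!phiM -!cMr !cMl !phiM xy subrr.
pose d a := phi (c (r a)).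
have dE x : d (phi x) = phi (c x) by apply: wd; rewrite rK.
have /cenA [s sE] : centroidal d.
  split=> [e a b|a b|a b]; rewrite -[a]rK -[b]rK.
  - by rewrite -linearP !dE cl linearP.
  - by rewrite -phiM !dE cMl phiM.
  by rewrite -phiM !dE cMr phiM.
by exists s => x; rewrite -dE.
Qed.

Lemma simple_neq0 (A : algebra k) : simple_alg A -> exists a : A, a != 0.
Proof.
case=> [[x [y xy]] _]; exists x; apply: contraNneq xy => ->.
by rewrite amul0l.
Qed.

End CentralSimple.

Lemma centroid_eq_homog (k : fieldType) (L : zmodType) (B : graded_algebra k L)
    (c d : centroid B) :
  (forall l x, gcomp B l x -> centroid_act c x = centroid_act d x) -> c = d.
Proof.
move=> cd; apply: centroid_eq.
exact: eq_linear_homog.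
Qed.

Lemma centroid_act0 (k : fieldType) (B : algebra k) (x : B) :
  centroid_act 0 x = 0.
Proof. by []. Qed.

Lemma centroid_actZ (k : fieldType) (B : algebra k) s (c : centroid B) (x : B) :
  centroid_act (s *: c) x = s *: centroid_act c x.
Proof. by []. Qed.

(** * The centroid of a cover: specialization and lifting *)

Section CoverCentroid.
Context {k : fieldType} {L M : zmodType} (pi : {additive L -> M}).
Context (B : graded_algebra k L) (A : graded_algebra k M) (phi : {linear B -> A}).
Hypothesis pi_surj : forall m, exists l, pi l = m.
Hypothesis cov : loop_cover pi phi.
Hypothesis csA : central_simple A.

Let phi_surj := cover_surj cov pi_surj.

(** Each centroid element acts through [phi] as a scalar, which is determined by its effect on one
    nonzero vector of [A]; this uniqueness makes the scalar linear and multiplicative in the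
    centroid element. *)
Lemma cover_specialization :
  exists2 rho : {scalar (centroid B)}, centroid_hom rho & specialization pi rho phi.
Proof.
have [phiM phil _ _] := cov.
have [r rP] : exists r : centroid B -> k,
    forall c x, phi (centroid_act c x) = r c *: phi x.
  apply: (exists_choice (P := fun c r => forall x, phi (centroid_act c x) = r *: phi x)).
  by move=> c; apply: centroid_scalar => //; apply: centroid_actP.
have [a a0] := simple_neq0 csA.2; have [x xa] := phi_surj a.
have rI (s t : k) : s *: a = t *: a -> s = t.
  move/eqP; rewrite -subr_eq0 -scalerBl scaler_eq0 (negPf a0) orbF subr_eq0.
  by move/eqP.
have rl : scalar r.
  move=> c d e; apply: rI.
  by rewrite -{1}xa -rP centroid_actPl linearP !rP xa scalerDl scalerA.
pose rho : {scalar (centroid B)} := HB.pack_for {scalar (centroid B)} r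
  (GRing.isLinear.Build k (centroid B) k *%R r rl).
exists rho; split=> //.
- by apply: rI; rewrite -xa -rP scale1r.
- by move=> c d; apply: rI; rewrite -xa -rP centroid_actM !rP scalerA.
by exists x; rewrite xa.
Qed.

(** The transfer of [c] commutes with multiplications because, on homogeneous arguments, both sides
    have the same degree and the same image under [phi]. *)
Lemma lift_centroid g (c : A -> A) : centroidal c ->
  (forall m a, gcomp A m a -> gcomp A (pi g + m) (c a)) ->
  exists z : centroid B,
    centroid_comp g z /\ forall x, phi (centroid_act z x) = c (phi x).
Proof.
move=> [cl cMl cMr] cg.
pose t := transfer cov cov (c := mk_linear cl) cg.
have tl l x : gcomp B l x -> gcomp B (g + l) (t x) by apply: transfer_gcomp.
have tE x : phi (t x) = c (phi x) by apply: transferE.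
have [phiM _ _ _] := cov.
have tP : centroidal t.
  apply: centroidal_homog => l m x y xl ym; apply: (cover_inj cov (tl _ _ (gcompM xl ym))).
  - by rewrite addrA; apply: gcompM => //; apply: tl.
  - by rewrite phiM !tE phiM cMl.
  - by rewrite addrCA; apply: gcompM => //; apply: tl.
  by rewrite phiM !tE phiM cMr.
by exists (mk_centroid tP); rewrite /centroid_comp mk_centroidE.
Qed.

(** For [g] in [G] the identity of [A] has degree [pi g] = 0, hence lifts to degree [g]; uniqueness
    of homogeneous lifts gives the group law. Nothing is known about [z] off [G]. *)
Lemma cover_shifts (G : zmodClosed L) :
  (forall l, (l \in G) = (pi l == 0)) -> exists z : L -> centroid B,
    [/\ forall g, g \in G -> centroid_comp g (z g),
        {in G &, forall g h, z (g + h) = z g ** z h}, z 0 = centroid1 &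
        forall g x, g \in G -> phi (centroid_act (z g) x) = phi x].
Proof.
move=> pi_ker.
have [z zP] : exists z : L -> centroid B, forall g, g \in G ->
    centroid_comp g (z g) /\ forall x, phi (centroid_act (z g) x) = phi x.
  apply: (exists_choice (P := fun g z => g \in G -> centroid_comp g z /\
    forall x, phi (centroid_act z x) = phi x)) => g.
  have [gG|gG] := boolP (g \in G); last by exists 0.
  have [//||z zP] := @lift_centroid g idfun; last by exists z.
  by move=> m a; rewrite (eqP (_ : pi g == 0)) ?add0r // -pi_ker.
have zl g l x : g \in G -> gcomp B l x -> gcomp B (g + l) (centroid_act (z g) x).
  by move=> gG; apply: (zP g gG).1.
have phiz g x : g \in G -> phi (centroid_act (z g) x) = phi x by move=> /zP [].
exists z; split=> // [g /zP [] //|g h gG hG|].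
  apply: centroid_eq_homog => l x xl; rewrite centroid_actM.
  apply: (cover_inj cov (zl _ _ _ (rpredD gG hG) xl)).
    by rewrite -addrA; do 2!apply: (zl) => //.
  by rewrite !phiz ?rpredD.
apply: centroid_eq_homog => l x xl.
apply: (cover_inj cov (zl _ _ _ (rpred0 _) xl)); first by rewrite add0r.
by rewrite phiz ?rpred0.
Qed.

End CoverCentroid.

Lemma group_alg_on_ind (k : fieldType) (L : zmodType) (G : zmodClosed L)
    (P : group_alg k L -> Prop) :
  is_subspace P -> (forall g, g \in G -> P (zpow k g)) ->
  forall p, group_alg_on_set G p -> P p.
Proof.
move=> hP Pz p [s [f [fP ->]]]; rewrite big_seq; apply: subspace_sum => // l.
by move=> /fP [lG [a ->]]; apply: subspaceZ => //; apply: Pz.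
Qed.

(** * A cover of a central-simple algebra lies in the class of (i) *)

Section CoverClass.
Context {k : fieldType} {L M : zmodType} (G : zmodClosed L) (pi : {additive L -> M}).
Hypothesis pi_surj : forall m, exists l, pi l = m.
Hypothesis pi_ker : forall l, (l \in G) = (pi l == 0).
Context (B : graded_algebra k L) (A : graded_algebra k M) (phi : {linear B -> A}).
Hypothesis cov : loop_cover pi phi.
Hypothesis csA : central_simple A.

Let phiM : {morph phi : x y / x ** y}. Proof. by case: cov. Qed.
Let phil l x : gcomp B l x -> gcomp A (pi l) (phi x).
Proof. by case: cov => _ + _ _; apply. Qed.
Let phi_inj0 l x : gcomp B l x -> phi x = 0 -> x = 0.
Proof. by case: cov => _ _ + _; apply. Qed.
Let phi_surj := cover_surj cov pi_surj.

Let shifts := cid (cover_shifts cov pi_ker).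

Let z : L -> centroid B := projT1 shifts.

Let zl g l x : g \in G -> gcomp B l x -> gcomp B (g + l) (centroid_act (z g) x).
Proof. by rewrite /z; case: shifts => /= f [fl _ _ _] gG; apply: fl. Qed.

Let zM : {in G &, forall g h, z (g + h) = z g ** z h}.
Proof. by rewrite /z; case: shifts => /= f []. Qed.

Let z0 : z 0 = centroid1.
Proof. by rewrite /z; case: shifts => /= f []. Qed.

Let phiz g x : g \in G -> phi (centroid_act (z g) x) = phi x.
Proof. by rewrite /z; case: shifts => /= f [_ _ _]; apply. Qed.

Let x0P : exists l x, gcomp B l x /\ x != 0.
Proof.
have [a a0] := simple_neq0 csA.2; have [x xa] := phi_surj a.
have [l xl] : exists l, hc l x != 0.
  by apply: exists_homog; apply: contraNneq a0 => x0; rewrite -xa x0 linear0.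
by exists l, (hc l x); split=> //; apply: hc_gcomp.
Qed.

(** On [A] the element [c] is a scalar [s], so for [g] in [G] it agrees with [s *: z g] after [phi].
    For [g] outside [G], [phi (c x)] lies in two distinct components of [A] at once and must
    vanish. *)
Lemma cover_centroid_comp g (c : centroid B) : centroid_comp g c ->
  exists s : k, c = if g \in G then s *: z g else 0.
Proof.
move=> cg.
have [s sP] : exists s, forall x, phi (centroid_act c x) = s *: phi x.
  by apply: centroid_scalar => //; apply: centroid_actP.
exists s; apply: centroid_eq_homog => l x xl; case: ifPn => gG.
  apply: (cover_inj cov (cg _ _ xl)).
    by rewrite centroid_actZ; apply: subspaceZ (gcomp_subspace _ _) (zl gG xl).
  by rewrite centroid_actZ linearZ /= phiz // sP.
rewrite centroid_act0; apply: (phi_inj0 (cg _ _ xl)).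
apply: (gcomp_disjoint (phil (cg _ _ xl)) (m := pi l)).
  by rewrite sP; apply: subspaceZ; [exact: gcomp_subspace | exact: phil].
by rewrite raddfD /= -subr_eq0 addrK -pi_ker.
Qed.

Lemma cover_graded_central : graded_central B.
Proof.
apply/seteqP; split=> [c /cover_centroid_comp [s]|_ [s _ <-] l x xl].
  by rewrite rpred0 z0 => ->; exists s.
by rewrite add0r centroid_actZ; apply: subspaceZ => //; apply: gcomp_subspace.
Qed.

Let z_neq0 g l x : g \in G -> gcomp B l x -> x != 0 -> centroid_act (z g) x != 0.
Proof.
move=> gG xl; apply: contra_neq => zx; apply: (phi_inj0 xl).
by rewrite -(phiz x gG) zx linear0.
Qed.

Lemma cover_central_grading_group : central_grading_group B = [set` G]%classic.
Proof.
apply/seteqP; split=> [g [c [/cover_centroid_comp [s ->]]]|g /= gG].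
  by rewrite /=; case: ifP.
have [l [x [xl x0]]] := x0P; exists (z g); split.
  by move=> m y ym; apply: zl.
by move=> zg0; have := z_neq0 gG xl x0; rewrite zg0 centroid_act0 eqxx.
Qed.

Let psi_sub (l m : L) : bilinear_for *:%R *:%R
  (fun a b : k^o => (a * b : k) *: z l).
Proof.
split=> [b c a a'|a c b b'] /=.
  by rewrite mulrDl -mulrA scalerDl !scalerA.
by rewrite mulrDr mulrCA scalerDl !scalerA.
Qed.

(** The linear map z^l -> [z l], written as a bilinear sum with the second argument frozen at z^0 so
    that its linearity comes from [bisum_bilinear]. It is meaningful on k[G] only, since [z] is
    uncontrolled off [G]. *)
Let psi_fun (p : group_alg k L) : centroid B :=
  bisum (fun l _ (a b : k^o) => (a * b : k) *: z l) p (zpow k 0).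

Let psi_linear : linear psi_fun.
Proof. by move=> c p q; apply: (bisum_bilinear psi_sub).1. Qed.

Let psi : {linear group_alg k L -> centroid B} := mk_linear psi_linear.

Let psi_z l : psi (zpow k l) = z l.
Proof. by rewrite -[LHS]/(psi_fun _) /psi_fun (bisum_single psi_sub) mulr1 scale1r. Qed.

Let psiM p q : group_alg_on_set G p -> group_alg_on_set G q ->
  psi (p ** q) = psi p ** psi q.
Proof.
move=> pG qG; move: p pG; apply: group_alg_on_ind => [|g gG].
  split=> [|a p p' IH IH']; first by rewrite amul0l (linear0 psi) amul0l.
  by rewrite amulDl amulZl !(linearP psi) IH IH' amulDl amulZl.
move: q qG; apply: group_alg_on_ind => [|h hG].
  split=> [|a p p' IH IH']; first by rewrite amul0r (linear0 psi) amul0r.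
  by rewrite amulDr amulZr !(linearP psi) IH IH' amulDr amulZr.
by rewrite zpowM !psi_z zM.
Qed.

(** The shifts of one homogeneous [x] sit in distinct degrees, so the coefficient of z^l is visible
    in degree [l + m]; this gives injectivity of [psi] on k[G]. *)
Let hc_psi p l m x : group_alg_on_set G p -> gcomp B m x -> l \in G ->
  hc (l + m) (centroid_act (psi p) x) = gcoef l p *: centroid_act (z l) x.
Proof.
move=> pG xm lG; move: p pG; apply: group_alg_on_ind => [|g gG].
  split=> [|a p q IH IH'].
    by rewrite (linear0 (gcoef l)) scale0r (linear0 psi) centroid_act0 linear0.
  by rewrite (linearP psi) centroid_actPl !linearP /= IH IH' scalerDl scalerA.
rewrite psi_z gcoef_zpow (hc_homog _ (zl gG xm)) (inj_eq (addIr m)).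
by case: eqP => [->|]; rewrite ?scale1r ?scale0r.
Qed.

Let psi_inj p q : group_alg_on_set G p -> group_alg_on_set G q ->
  psi p = psi q -> p = q.
Proof.
move=> pG qG pq; apply: group_algP => l.
have [lG|lG] := boolP (l \in G); last first.
  by rewrite (proj1 (group_alg_onE G p)) // (proj1 (group_alg_onE G q)).
have [m [x [xm x0]]] := x0P.
have := hc_psi pG xm lG; rewrite pq hc_psi // => /eqP.
rewrite -subr_eq0 -scalerBl scaler_eq0 subr_eq0 (negPf (z_neq0 lG xm x0)) orbF.
by move/eqP.
Qed.

(** Each component of [c] of degree d in [G] is a multiple [s d] of [z d]. Only finitely many [s d]
    are nonzero, because [c x] has finite support for a fixed nonzero homogeneous [x], while no
    [z d] kills [x]. *)
Let psi_surj (c : centroid B) : exists2 p, group_alg_on_set G p & psi p = c.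
Proof.
have [m [x [xm x0]]] := x0P.
have [s sP] : exists s : L -> k, forall d l y, gcomp B l y ->
    hc (d + l) (centroid_act c y) = if d \in G then s d *: centroid_act (z d) y else 0.
  apply: (exists_choice (P := fun d (s : k) => forall l y, gcomp B l y ->
    hc (d + l) (centroid_act c y) = if d \in G then s *: centroid_act (z d) y else 0)).
  move=> d; have [cd cdP cdE] := centroid_component d (centroid_actP c).
  have [|s sE] := @cover_centroid_comp d (mk_centroid cdP).
    by move=> l y yl; rewrite mk_centroidE (cdE _ _ yl); apply: hc_gcomp.
  exists s => l y yl.
  rewrite -(cdE _ _ yl) -[LHS](congr1 (fun h => h y) (mk_centroidE cdP)) sE.
  by case: ifP.
(* The degrees d in [G] for which [c x] has a component in degree [d + m]; [undup] makes the list
   duplicate-free, so that a single summand can be extracted later. *)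
pose D := [seq d <- undup [seq l - m | l <- msupp (decomp (centroid_act c x))]
  | d \in G].
have DG d : d \in D -> d \in G by rewrite mem_filter => /andP [].
have sD d : d \in G -> d \notin D -> s d = 0.
  move=> dG; rewrite mem_filter dG mem_undup /= => dD; apply/eqP.
  have : hc (d + m) (centroid_act c x) == 0.
    apply/eqP/mcoeff_outdom; apply: contra dD => dm.
    by apply/mapP; exists (d + m); rewrite ?addrK.
  by rewrite sP // dG scaler_eq0 (negPf (z_neq0 dG xm x0)) orbF.
have pG : group_alg_on_set G (\sum_(d <- D) s d *: zpow k d).
  exists D, (fun d => s d *: zpow k d); split=> // d dD.
  by split; [exact: DG | exists (s d)].
have gp d : d \in G -> gcoef d (\sum_(d <- D) s d *: zpow k d) = s d.
  move=> dG; rewrite linear_sum /=; have [dD|dD] := boolP (d \in D).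
    rewrite (bigD1_seq d) ?filter_uniq ?undup_uniq //= linearZ /= gcoef_zpow eqxx.
    rewrite -[X in X + _]/(_ * _) mulr1 big1 ?addr0 // => e ed.
    by rewrite linearZ /= gcoef_zpow (negPf ed) scaler0.
  rewrite sD // big_seq big1 // => e eD; rewrite linearZ /= gcoef_zpow.
  case: eqVneq => [ed|_]; last by rewrite scaler0.
  by rewrite -ed eD in dD.
exists (\sum_(d <- D) s d *: zpow k d) => //.
apply: centroid_eq_homog => l y yl; apply: hc_inj => n.
(* The degree [n] part of a value at [y] of degree [l] sees only the component of degree [n - l] of
   the centroid element; outside [G] both sides vanish. *)
rewrite -[n](subrK l); have [nG|nG] := boolP (n - l \in G).
  by rewrite hc_psi // gp // sP // nG.
rewrite sP // (negPf nG).
move: (\sum_(d <- D) _) pG {gp}; apply: group_alg_on_ind => [|g gG].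
  split=> [|a p q IH IH'].
    by rewrite (linear0 psi) centroid_act0 linear0.
  by rewrite (linearP psi) centroid_actPl linearP /= IH IH' scaler0 addr0.
rewrite psi_z (hc_homog _ (zl gG yl)) (inj_eq (addIr l)).
by case: eqVneq => // gn; rewrite -gn gG in nG.
Qed.

Lemma cover_split_centroid : split_centroid B.
Proof.
exists G; split; first by rewrite cover_central_grading_group.
have [f fP] : exists f : centroid B -> group_alg_on k G,
    forall c, psi (elt_val (f c)) = c.
  apply: (exists_choice (P := fun c (p : group_alg_on k G) => psi (elt_val p) = c)) => c.
  have [p pG pc] := psi_surj c.
  by exists (mk_elt (group_alg_on_subspace k G) pG).
have psiI (p q : group_alg_on k G) : psi (elt_val p) = psi (elt_val q) -> p = q.
  by move=> pq; apply: val_inj; apply: psi_inj pq; apply: subspace_eltP.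
have fl : linear f.
  by move=> a c d; apply: psiI; rewrite fP (linearP psi) !fP.
exists (mk_linear fl); split=> [|c d|l] /=.
- exists (fun p => psi (elt_val p)) => [c|p]; first exact: fP.
  by apply: psiI; rewrite fP.
- by apply: psiI; rewrite fP psiM ?fP //; apply: subspace_eltP.
apply/seteqP; split=> [_ [c /cover_centroid_comp [s ->] <-]|p [a pa]].
  exists (if l \in G then s else 0).
  case: ifP => lG; last first.
    have -> : f 0 = 0 by have := fl (-1) 0 0; rewrite scaler0 addr0 scaleN1r addNr.
    by rewrite scale0r.
  apply: psi_inj; rewrite ?fP; first exact: subspace_eltP.
    by apply/group_alg_onE => m mG; rewrite linearZ /= gcoef_zpow;
      case: eqVneq => [lm|]; [rewrite -lm lG in mG | rewrite scaler0].
  by rewrite linearZ psi_z.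
exists (psi (elt_val p)); last by apply: psiI; rewrite fP.
have [lG|lG] := boolP (l \in G).
  rewrite pa linearZ psi_z => m x xm.
  by rewrite centroid_actZ; apply: subspaceZ (gcomp_subspace _ _) _; apply: zl.
have := (group_alg_onE G (elt_val p)).1 (subspace_eltP p) l lG.
rewrite pa linearZ /= gcoef_zpow eqxx -[X in X = _]/(_ * _) mulr1 => ->.
move=> m x xm; rewrite -[centroid_act _ x]/(centroid_act (psi _) x) scale0r (linear0 psi).
by rewrite centroid_act0; apply: (gcomp_subspace _ _).1.
Qed.

Let image_ideal (I : set B) : is_ideal I -> is_ideal (image I phi).
Proof.
move=> [hI IM]; split; first split=> [|a _ _ [x Ix <-] [y Iy <-]].
- by exists 0; [exact: hI.1 | rewrite linear0].
- by exists (a *: x + y); [exact: hI.2 | rewrite linearP].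
move=> b _ [x Ix <-]; have [y <-] := phi_surj b; rewrite -!phiM.
by split; [exists (y ** x) => //; exact: (IM y x Ix).1 |
  exists (x ** y) => //; exact: (IM y x Ix).2].
Qed.

(* The elements of [I] all of whose shifts lie in [I] form an ideal containing
   [I B] and [B I], so its image under [phi] is still all of [A]. *)
Lemma cover_graded_simple : graded_simple B.
Proof.
have [[a [b ab]] simA] := csA.2; split.
  have [x xa] := phi_surj a; have [y yb] := phi_surj b; exists x, y.
  by apply: contraNneq ab => xy; rewrite -xa -yb -phiM xy linear0.
move=> I grI; have [hI _] := grI.
have [I0|I0] := pselect (exists x, I x /\ x != 0); last first.
  left; apply/seteqP; split=> [x Ix /=|x /= ->]; last exact: hI.1.1.
  by apply: contrapT => /eqP x0; apply: I0; exists x.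
right.
(* A nonzero graded ideal contains a nonzero homogeneous element, which [phi] does not kill. *)
have phiI : image I phi = setT.
  have [phiI|//] := simA _ (image_ideal hI).
  have [x [Ix /exists_homog [l xl]]] := I0; case/eqP: xl.
  apply: (phi_inj0 (hc_gcomp l x)).
  have : image I phi (phi (hc l x)).
    by exists (hc l x) => //; apply: graded_ideal_hc.
  by rewrite phiI.
pose S : set B := fun x => I x /\ forall g, g \in G -> I (centroid_act (z g) x).
have hS : is_ideal S.
  split; first split=> [|c x y [Ix zx] [Iy zy]].
  - split=> [|g _]; first exact: hI.1.1.
    by rewrite linear0; apply: hI.1.1.
  - split=> [|g gG]; first exact: hI.1.2.
    rewrite linearP.
    by apply: hI.1.2; [exact: zx | exact: zy].
  move=> y x [Ix zx]; split; split.
  - exact: (hI.2 y x Ix).1.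
  - move=> g gG; have [_ _ ->] := centroid_actP (z g).
    exact: (hI.2 y _ (zx g gG)).1.
  - exact: (hI.2 y x Ix).2.
  move=> g gG; have [_ -> _] := centroid_actP (z g).
  exact: (hI.2 y _ (zx g gG)).2.
have phiS : image S phi = setT.
  have [phiS|//] := simA _ (image_ideal hS).
  have [x Ix xa] : image I phi a by rewrite phiI.
  have [y yb] := phi_surj b.
  have : image S phi (a ** b).
    exists (x ** y); last by rewrite phiM xa yb.
    split=> [|g gG]; first exact: (hI.2 y x Ix).2.
    have [_ _ ->] := centroid_actP (z g); exact: (hI.2 _ x Ix).2.
  by rewrite phiS /= => ab0; rewrite ab0 eqxx in ab.
apply/seteqP; split=> // y _; move: y; apply: homog_ind => [|x y Ix Iy|l y yl].
- exact: hI.1.1.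
- exact: subspaceD hI.1 Ix Iy.
have [x [_ zx] xy] : image S phi (phi y) by rewrite phiS.
(* The components of [x] in degrees congruent to [l] modulo [G] are all shifted to degree [l]. Their
   sum has image the degree [pi l] part of [phi x] = [phi y], so it equals [y] by injectivity in
   degree [l]. *)
pose F m := centroid_act (z (l - m)) (hc m x).
have -> : y = \sum_(m <- msupp (decomp x) | l - m \in G) F m.
  apply: (cover_inj cov yl).
    apply: subspace_sum (gcomp_subspace B l) _ => m mG.
    by rewrite -{1}(subrK m l); apply: zl => //; apply: hc_gcomp.
  rewrite linear_sum -(hc_id (phil yl)) -xy {1}[x]decompE !linear_sum /=.
  rewrite [RHS]big_mkcond; apply: eq_bigr => m _ /=.
  rewrite (hc_homog _ (phil (hc_gcomp m x))) pi_ker raddfB subr_eq0 eq_sym.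
  case: eqP => // lm; rewrite phiz // pi_ker raddfB lm subrr //.
apply: subspace_sum hI.1 _ => m mG; rewrite /F.
(* A shifted component of [x] is a component of the shifted [x], which lies in [I] by the choice of
   [S]; gradedness of [I] then applies. *)
have -> : centroid_act (z (l - m)) (hc m x) = hc l (centroid_act (z (l - m)) x).
  rewrite {2}[x]decompE linear_sum linear_sum /=.
  have E n : hc l (centroid_act (z (l - m)) (hc n x)) =
      if n == m then centroid_act (z (l - m)) (hc m x) else 0.
    rewrite (hc_homog _ (zl mG (hc_gcomp n x))) -{2}(subrK m l).
    by rewrite (inj_eq (addrI _)); case: eqP => // ->.
  rewrite (eq_bigr (fun n => if n == m then centroid_act (z (l - m)) (hc m x) else 0)).
    have [mD|mD] := boolP (m \in msupp (decomp x)).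
      rewrite (big_fsetD1 m) //= eqxx big_seq big1 ?addr0 // => n.
      by rewrite in_fsetD1 => /andP [/negPf ->].
    rewrite /hc mcoeff_outdom // linear0 big_seq big1 // => n.
    by case: eqP.
  by move=> n _; apply: E.
apply: graded_ideal_hc => //; exact: zx.
Qed.

Lemma cover_classB : classB G B.
Proof.
split; first by split; [exact: cover_graded_central | exact: cover_graded_simple].
  exact: cover_split_centroid.
exact: cover_central_grading_group.
Qed.

End CoverClass.

(** * From graded-simple to simple *)

Section GradedSimple.
Context {k : fieldType} {M : zmodType} (A : graded_algebra k M).

(* If [x] is a nonzero element of the ideal [J] with the fewest nonzero
   components and [m1] lies in its support [S], then an element of [J] with
   support in [d + S] is determined by its component of degree [d + m1].
   For [m2] in [S], sending that component to the one of degree [d + m2] defines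
   an element of the centroid of degree [m2 - m1]. *)
Lemma graded_simple_simple : graded_simple A ->
  (forall d (c : A -> A), d != 0 -> centroidal c ->
    (forall m a, gcomp A m a -> gcomp A (d + m) (c a)) -> forall a, c a = 0) ->
  simple_alg A.
Proof.
move=> [nzA gsA] cen; split=> // J [hJ JM].
have [J0|J0] := pselect (exists x, J x /\ x != 0); last first.
  left; apply/seteqP; split=> [x Jx /=|x /= ->]; last exact: hJ.1.
  by apply: contrapT => /eqP x0; apply: J0; exists x.
right.
pose P n := `[< exists x, [/\ J x, x != 0 & #|` msupp (decomp x)| = n] >].
have exP : exists n, P n.
  by have [x [Jx x0]] := J0; exists #|` msupp (decomp x)|; apply/asboolP; exists x.
have [n /asboolP [x [Jx x0 xn]] nmin] := ex_minnP exP.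
have [m1 xm1] := exists_homog x0.
pose S := msupp (decomp x).
have m1S : m1 \in S by rewrite -mcoeff_neq0.
(* Elements of [J] supported in the translate [d + S]. If moreover the component at [d + m1]
   vanishes, the support has fewer than [n] elements, so minimality forces the element to be 0. *)
pose Js d y := J y /\ forall m, m \notin S -> hc (d + m) y = 0.
have Js0 d y : Js d y -> hc (d + m1) y = 0 -> y = 0.
  move=> [Jy ys] y1; apply: contrapT => /eqP y0.
  have : (n <= #|` msupp (decomp y)|)%N by apply/nmin/asboolP; exists y.
  rewrite leqNgt => /negP; apply.
  have sub : (msupp (decomp y) `<=` [fset (d + m)%R | m in (S `\ m1)])%fset.
    apply/fsubsetP => l ly; apply/imfsetP; exists (l - d); last by rewrite addrC subrK.
    rewrite /= in_fsetD1; apply/andP; split.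
      by apply: contraTneq ly => ld; rewrite -mcoeff_eq0 -(subrK d l) ld addrC;
        apply/eqP.
    apply: contraTT ly => lS; rewrite -mcoeff_eq0; apply/eqP.
    by have := ys _ lS; rewrite addrC subrK.
  apply: leq_ltn_trans (fsubset_leq_card sub) _.
  rewrite card_imfset /=; last exact: addrI.
  by rewrite -xn [in X in (_ < X)%N](cardfsD1 m1) m1S.
have Js_sub d : is_subspace (Js d).
  split=> [|c y y' [Jy ys] [Jy' ys']].
    by split=> [|m _]; [exact: hJ.1 | rewrite linear0].
  split=> [|m mS]; first exact: hJ.2.
  by rewrite linearP /= ys // ys' // scaler0 addr0.
have JsM d l b y : gcomp A l b -> Js d y -> Js (l + d) (b ** y) /\ Js (l + d) (y ** b).
  move=> bl [Jy ys]; split; split.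
  - exact: (JM b y Jy).1.
  - by move=> m mS; rewrite -addrA hc_mull // ys // amul0r.
  - exact: (JM b y Jy).2.
  by move=> m mS; rewrite -addrA addrC hc_mulr // ys // amul0l.
(* Vectors whose every component occurs as the component at the position of [m1] of an element of
   [J] supported in a translate of [S]. This graded ideal contains the nonzero component of [x] in
   degree [m1], hence is everything, and so [Y] below is defined on all homogeneous vectors. *)
pose U : set A := fun a => forall l, exists2 y, Js (l - m1) y & hc l y = hc l a.
have U_ideal : graded_ideal U.
  apply: graded_idealP => [|a l Ua m|l m b a bl am Ua].
  - split=> [l|c a b Ua Ub l]; first by exists 0; [exact: (Js_sub _).1 | ].
    have [y ys ya] := Ua l; have [y' ys' ya'] := Ub l.
    by exists (c *: y + y'); [exact: (Js_sub _).2 | rewrite !linearP /= ya ya'].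
  - rewrite (hc_homog m (hc_gcomp l a)).
    case: eqVneq => [<-|_]; last by exists 0; [exact: (Js_sub _).1 | rewrite linear0].
    by have [y ys ya] := Ua l; exists y; rewrite // ya hc_id //; apply: hc_gcomp.
  have [y ys ya] := Ua m.
  have [ys1 ys2] := JsM _ _ _ _ bl ys; rewrite addrA in ys1 ys2.
  split=> p.
    rewrite (hc_homog p (gcompM bl am)); case: eqVneq => [<-|_]; last first.
      by exists 0; [exact: (Js_sub _).1 | rewrite linear0].
    by exists (b ** y); rewrite // hc_mull // ya hc_id.
  rewrite (hc_homog p (gcompM am bl)); case: eqVneq => [<-|_]; last first.
    by exists 0; [exact: (Js_sub _).1 | rewrite linear0].
  by exists (y ** b); rewrite [m + l]addrC // addrC hc_mulr // ya hc_id.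
have Ux : U (hc m1 x).
  move=> l; rewrite (hc_homog l (hc_gcomp m1 x)).
  case: eqVneq => [<-|_]; last by exists 0; [exact: (Js_sub _).1 | rewrite linear0].
  exists x; rewrite // subrr; split=> // m mS.
  by rewrite add0r; apply: mcoeff_outdom.
have UT : U = setT.
  have [U0|//] := gsA _ U_ideal.
  by move: Ux; rewrite U0 /= => x10; rewrite x10 eqxx in xm1.
pose Y l a : A := xget 0 [set y | Js (l - m1) y /\ hc l y = a]%classic.
have YP l a : gcomp A l a -> Js (l - m1) (Y l a) /\ hc l (Y l a) = a.
  move=> al; have : U a by rewrite UT.
  move=> /(_ l) [y ys ya]; rewrite /Y; case: xgetP => [//|/(_ y)].
  by case; split=> //; rewrite ya hc_id.
have Yuniq l a y : gcomp A l a -> Js (l - m1) y -> hc l y = a -> Y l a = y.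
  move=> al ys ya; have [Ys Ya] := YP _ _ al.
  apply/eqP; rewrite -subr_eq0; apply/eqP; apply: (Js0 (l - m1)).
    exact: subspaceB (Js_sub _) Ys ys.
  by rewrite subrK linearB /= Ya ya subrr.
(* A second degree [m2] in [S] would give a centroid element of nonzero degree [m2 - m1], which
   vanishes by hypothesis; but it carries the component of [x] in degree [m1] to the nonzero one in
   degree [m2]. *)
have S1 m2 : m2 \in S -> m2 = m1.
  move=> m2S; apply: contrapT => /eqP m12.
  have fP l : linear_on (gcomp A l) (fun a => hc (m2 - m1 + l) (Y l a)).
    move=> c a b al bl; have [Ya aY] := YP _ _ al; have [Yb bY] := YP _ _ bl.
    rewrite (Yuniq _ _ (c *: Y l a + Y l b)) ?linearP /= ?aY ?bY //.
      exact: (gcomp_subspace A l).2.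
    exact: (Js_sub _).2.
  pose c := gluing fP.
  have cE l a y : gcomp A l a -> Js (l - m1) y -> hc l y = a ->
      c a = hc (m2 - m1 + l) y.
    by move=> al ys ya; rewrite /c (gluingE _ al) (Yuniq _ _ y).
  have cP : centroidal c.
    apply: centroidal_homog => l m a b al bm.
      have [Ya aY] := YP _ _ al; have [_ ys] := JsM _ _ _ _ bm Ya.
      rewrite (cE _ _ (Y l a ** b) (gcompM al bm)); last 2 first.
      - by rewrite addrAC addrC.
      - by rewrite hc_mulr // aY.
      by rewrite (cE _ _ _ al Ya aY) addrA hc_mulr.
    have [Yb bY] := YP _ _ bm; have [ys _] := JsM _ _ _ _ al Yb.
    rewrite (cE _ _ (a ** Y m b) (gcompM al bm)); last 2 first.
    - by rewrite -addrA.
    - by rewrite hc_mull // bY.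
    by rewrite (cE _ _ _ bm Yb bY) addrCA hc_mull.
  have cd m a : gcomp A m a -> gcomp A (m2 - m1 + m) (c a).
    move=> am; have [Ya aY] := YP _ _ am; rewrite (cE _ _ _ am Ya aY).
    exact: hc_gcomp.
  have := cen _ _ _ cP cd (hc m1 x); rewrite subr_eq0 => /(_ m12).
  have xs : Js (m1 - m1) x.
    by split=> // m mS; rewrite subrr add0r; apply: mcoeff_outdom.
  rewrite (cE m1 _ x (hc_gcomp m1 x) xs erefl) subrK => /eqP.
  by rewrite [_ == _]mcoeff_eq0 m2S.
have xE : x = hc m1 x.
  apply: hc_inj => l; rewrite (hc_homog l (hc_gcomp m1 x)).
  by case: eqVneq => [->|lm] //; apply: mcoeff_outdom; apply: contra lm => /S1 ->.
(* The largest graded ideal inside [J]; it is nonzero because [x] has turned out to be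
   homogeneous. *)
pose V : set A := fun a => forall l, J (hc l a).
have V_ideal : graded_ideal V.
  apply: graded_idealP => [|a l Va m|l m b a bl am Va].
  - split=> [l|c a b Va Vb l]; first by rewrite linear0; apply: hJ.1.
    by rewrite linearP; apply: hJ.2; [exact: Va | exact: Vb].
  - by rewrite (hc_homog m (hc_gcomp l a)); case: eqP => // _; exact: hJ.1.
  have Ja : J a by have := Va m; rewrite hc_id.
  split=> p; [rewrite (hc_homog p (gcompM bl am)) | rewrite (hc_homog p (gcompM am bl))].
    by case: eqP => _; [exact: (JM b a Ja).1 | exact: hJ.1].
  by case: eqP => _; [exact: (JM b a Ja).2 | exact: hJ.1].
have Vx : V x.
  move=> l; rewrite xE (hc_homog l (hc_gcomp m1 x)) -xE.
  by case: eqP => _ //; apply: hJ.1.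
have VT : V = setT.
  have [V0|//] := gsA _ V_ideal.
  by move: Vx; rewrite V0 /= => x00; rewrite x00 eqxx in x0.
apply/seteqP; split=> // a _; rewrite [a]decompE; apply: subspace_sum => // l _.
have Va : V a by rewrite VT.
exact: Va.
Qed.

End GradedSimple.

(** * Covers and specializations of a graded-central-simple algebra with split centroid *)

Section GradedCentralSimple.
Context {k : fieldType} {L M : zmodType} (G : zmodClosed L) (pi : {additive L -> M}).
Hypothesis pi_surj : forall m, exists l, pi l = m.
Hypothesis pi_ker : forall l, (l \in G) = (pi l == 0).
Context (B : graded_algebra k L).
Hypothesis clB : classB G B.

Lemma split_shifts : exists z : L -> centroid B,
  [/\ forall g, g \in G -> centroid_comp g (z g),
      {in G &, forall g h, z (g + h) = z g ** z h} & z 0 = centroid1].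
Proof.
have [_ [G' [G'E [f [[f' fK f'K] fM fE]]]] GE] := clB.
have GG' g : g \in G -> g \in G'.
  by move=> gG; have : [set` G']%classic g by rewrite G'E GE.
have zS g : g \in G -> group_alg_on_set G' (zpow k g).
  move=> /GG' gG; apply/group_alg_onE => l lG; rewrite gcoef_zpow.
  by case: eqVneq => // gl; rewrite -gl gG in lG.
have [z zP] : exists z : L -> centroid B,
    forall g, g \in G -> elt_val (f (z g)) = zpow k g.
  apply: (exists_choice (P := fun g c => g \in G -> elt_val (f c) = zpow k g)) => g.
  have [gG|] := boolP (g \in G); last by exists 0.
  by exists (f' (mk_elt (group_alg_on_subspace k G') (zS g gG))); rewrite f'K.
have zM g h : g \in G -> h \in G -> z (g + h) = z g ** z h.
  move=> gG hG; apply: (can_inj fK); apply: val_inj; rewrite /= zP ?rpredD // fM.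
  by rewrite -[RHS]/(elt_val (f (z g)) ** elt_val (f (z h))) !zP // zpowM.
exists z; split=> // [g gG|].
  have : group_comp g (f (z g)) by exists 1; rewrite scale1r zP.
  by rewrite -fE => -[c cg /(can_inj fK) <-].
apply: (can_inj fK); apply: val_inj; rewrite /= zP ?rpred0 //.
(* The isomorphism [f] is not assumed unital. As z^0 acts as the identity on the group algebra,
   [f centroid1] = z^0 [f centroid1] = [f (z 0 ** centroid1)] = [f (z 0)]. *)
have z1 : z 0 ** centroid1 = z 0 by apply: centroid_eq.
have fz1 : f centroid1 = f (z 0 ** centroid1).
  rewrite fM; apply: val_inj; apply: group_algP => l.
  rewrite -[RHS]/(gcoef l (elt_val (f (z 0)) ** elt_val (f centroid1))).
  rewrite -[LHS]/(gcoef l (elt_val (f centroid1))).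
  rewrite zP ?rpred0 //.
  move: (f centroid1) => p; congr gcoef.
  have : group_alg_on_set G' (elt_val p) by exact: subspace_eltP.
  move: (elt_val p) => {p}.
  apply: group_alg_on_ind => [|h hG]; last by rewrite zpowM add0r.
  split=> [|a u v uE vE]; first by rewrite amul0r.
  by rewrite amulDr amulZr -uE -vE.
by rewrite fz1 z1 zP ?rpred0.
Qed.

Lemma classB_centroid_comp g (c : centroid B) :
  g \notin G -> centroid_comp g c -> c = 0.
Proof.
have [_ _ GE] := clB => gG cg; apply: contrapT => c0.
suff : [set` G]%classic g by rewrite /= (negPf gG).
by rewrite -GE; exists c.
Qed.

Lemma classB_cover_central_simple (A : graded_algebra k M) (phi : {linear B -> A}) :
  loop_cover pi phi -> central_simple A.
Proof.
move=> cov; have phi_surj := cover_surj cov pi_surj.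
have [phiM phil phi0 _] := cov.
have [[gcB [[x [y xy]] gsB]] _ _] := clB.
have c0 d (c : A -> A) : d != 0 -> centroidal c ->
    (forall m a, gcomp A m a -> gcomp A (d + m) (c a)) -> forall a, c a = 0.
  move=> d0 cP cd a; have [l ld] := pi_surj d.
  have cl m u : gcomp A m u -> gcomp A (pi l + m) (c u) by rewrite ld; apply: cd.
  have [t [tl tE]] := lift_centroid cov cP cl.
  have lG : l \notin G by rewrite pi_ker ld.
  have [u <-] := phi_surj a.
  by rewrite -tE (classB_centroid_comp lG tl) centroid_act0 linear0.
have c1 (c : A -> A) : centroidal c ->
    (forall m a, gcomp A m a -> gcomp A m (c a)) -> exists s, forall a, c a = s *: a.
  move=> cP cd.
  have cl m u : gcomp A m u -> gcomp A (pi 0 + m) (c u).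
    by rewrite raddf0 add0r; apply: cd.
  have [t [tl tE]] := lift_centroid cov cP cl.
  have : range (fun a : k => a *: @centroid1 _ B) t by rewrite -gcB.
  case=> s _ st; exists s => a; have [u <-] := phi_surj a.
  by rewrite -tE -st centroid_actZ linearZ.
split.
  apply/central_algP => c cP.
  have [e eP eE] := centroid_component 0 cP.
  have [|s sE] := c1 e eP.
    by move=> m a am; rewrite (eE _ _ am) add0r; apply: hc_gcomp.
  exists s; have [cl _ _] := cP.
  suff : mk_linear cl =1 ( *:%R s : {linear A -> A}) by [].
  apply: eq_linear_homog => m a am; rewrite /= -sE (eE _ _ am) add0r.
  apply: hc_inj => n; rewrite (hc_homog n (hc_gcomp _ _)).
  (* The part of [c a] in a degree [n] other than [m] is the value at [a] of the component of [c] of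
     degree [n - m], which is nonzero, so that component vanishes. *)
  case: eqVneq => [<-//|mn]; have [d dP dE] := centroid_component (n - m) cP.
  rewrite -{1}(subrK m n) -(dE _ _ am); apply: (c0 (n - m)) => //.
    by rewrite subr_eq0 eq_sym.
  by move=> p b bp; rewrite (dE _ _ bp); apply: hc_gcomp.
apply: graded_simple_simple => //; split.
  have [l xl] : exists l, hc l x ** y != 0.
    apply: contrapT => nx; case/eqP: xy.
    rewrite [x]decompE; apply: (big_ind (fun x => x ** y = 0)) => [|u v hu hv|l _].
    - by rewrite amul0l.
    - by rewrite amulDl hu hv addr0.
    by apply: contrapT => /eqP lx; apply: nx; exists l.
  have [m yl] : exists m, hc l x ** hc m y != 0.
    apply: contrapT => ny; case/eqP: xl.
    rewrite [y]decompE; apply: (big_ind (fun y => _ ** y = 0)) => [|u v hu hv|m _].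
    - by rewrite amul0r.
    - by rewrite amulDr hu hv addr0.
    by apply: contrapT => /eqP my; apply: ny; exists m.
  exists (phi (hc l x)), (phi (hc m y)); rewrite -phiM.
  by apply: contra_neq yl => /(phi0 (l + m) _ (gcompM (hc_gcomp l x) (hc_gcomp m y))).
move=> J grJ; have [[hJ JM] _] := grJ.
(* The plain preimage of [J] need not be graded, since it contains the kernel of [phi]; testing
   components one by one repairs this. *)
pose I : set B := fun u => forall l, J (phi (hc l u)).
have [|I0|IT] := gsB I; last 2 first.
- left; apply/seteqP; split=> [a Ja|_ ->]; last exact: hJ.1.
  apply: hc_inj => m; rewrite linear0.
  have [l lm] := pi_surj m; have := hc_gcomp m a; rewrite -lm => am.
  have [_ _ _ /(_ l _ am) [u ul ua]] := cov.
  have Iu : I u.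
    move=> n; rewrite (hc_homog n ul); case: eqP => _; last by rewrite linear0; apply: hJ.1.
    by rewrite ua; apply: graded_ideal_hc.
  by rewrite -ua; move: Iu; rewrite I0 => ->; rewrite linear0.
- right; apply/seteqP; split=> // a _; have [u <-] := phi_surj a.
  have Iu : I u by rewrite IT.
  by rewrite [u]decompE linear_sum; apply: subspace_sum => // l _; apply: Iu.
apply: graded_idealP => [|u l Iu m|l m b u bl um Iu].
- split=> [l|s u v Iu Iv l]; first by rewrite !linear0; apply: hJ.1.
  by rewrite !linearP; apply: hJ.2; [exact: Iu | exact: Iv].
- rewrite (hc_homog m (hc_gcomp l u)); case: eqP => // _.
  by rewrite linear0; apply: hJ.1.
have Ju : J (phi u) by have := Iu m; rewrite hc_id.
split=> p; [rewrite (hc_homog p (gcompM bl um)) | rewrite (hc_homog p (gcompM um bl))].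
  case: eqP => _; last by rewrite linear0; apply: hJ.1.
  by rewrite phiM; apply: (JM (phi b) (phi u) Ju).1.
case: eqP => _; last by rewrite linear0; apply: hJ.1.
by rewrite phiM; apply: (JM (phi b) (phi u) Ju).2.
Qed.

(** Injectivity on components holds because the largest graded ideal in the kernel of [phi] is
    proper, hence 0. Surjectivity follows by moving the relevant components of any preimage to the
    required degree by shifts. *)
Lemma specialization_cover (A : graded_algebra k M) (rho : {scalar (centroid B)})
    (phi : {linear B -> A}) :
  centroid_hom rho -> specialization pi rho phi -> loop_cover pi phi.
Proof.
move=> [rho1 rhoM] [[x0 px0] phiM phi_surj phil phic].
have [z [zl zM z0]] := split_shifts.
have [[_ [_ gsB]] _ _] := clB.
split=> //.
  pose K : set B := fun u => forall l, phi (hc l u) = 0.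
  have grK : graded_ideal K.
    apply: graded_idealP => [|u l Ku m|l m b u bl um Ku].
    - split=> [l|s u v Ku Kv l]; first by rewrite !linear0.
      by rewrite !linearP /= Ku Kv scaler0 addr0.
    - by rewrite (hc_homog m (hc_gcomp l u)); case: eqP => // _; rewrite linear0.
    have pu : phi u = 0 by have := Ku m; rewrite hc_id.
    split=> p; [rewrite (hc_homog p (gcompM bl um)) | rewrite (hc_homog p (gcompM um bl))].
      by case: eqP => _; rewrite ?linear0 // phiM pu amul0r.
    by case: eqP => _; rewrite ?linear0 // phiM pu amul0l.
  have [K0|KT] := gsB K grK.
    move=> l x xl px; have : K x.
      by move=> m; rewrite (hc_homog m xl); case: eqP => // _; rewrite linear0.
    by rewrite K0.
  have Kx : K x0 by rewrite KT.
  by case/eqP: px0; rewrite [x0]decompE linear_sum big1 // => l _; apply: Kx.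
move=> l a al; have [x xa] := phi_surj a.
(* Under [phi] the shift by g multiplies by [rho (z g)], and [rho (z (- g))] is the factor that
   undoes this. *)
have rz g : g \in G -> rho (z (- g)) * rho (z g) = 1.
  by move=> gG; rewrite -rhoM -zM ?rpredN // addNr z0.
exists (\sum_(m <- msupp (decomp x) | l - m \in G)
    rho (z (- (l - m))) *: centroid_act (z (l - m)) (hc m x)).
  apply: subspace_sum (gcomp_subspace B l) _ => m mG.
  apply: subspaceZ (gcomp_subspace B l) _.
  by rewrite -{1}(subrK m l); apply: zl => //; apply: hc_gcomp.
rewrite linear_sum -(hc_id al) -xa [X in _ = hc _ (phi X)]decompE !linear_sum /=.
rewrite big_mkcond.
apply: eq_bigr => m _ /=; rewrite (hc_homog _ (phil _ _ (hc_gcomp m x))).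
rewrite pi_ker raddfB subr_eq0 eq_sym; case: eqP => // lm.
by rewrite linearZ /= phic scalerA rz ?scale1r // pi_ker raddfB lm subrr.
Qed.

End GradedCentralSimple.

(** * Existence of a covered algebra *)

Lemma is_direct_sum_projections (k : fieldType) (V : lmodType k) (M : choiceType)
    (F : M -> set V) (p : M -> {linear V -> V}) :
  (forall m, is_subspace (F m)) -> (forall m v, F m (p m v)) ->
  (forall m n v, F m v -> p n v = if m == n then v else 0) ->
  (forall v, exists D : {fset M}, v = \sum_(m <- D) p m v) -> is_direct_sum F.
Proof.
move=> Fsub Fp pF pD; split=> // v; have [D vD] := pD v.
pose f : dirsum V M := \sum_(m <- D) << p m v *g m >>.
have fE m : f@_m = if m \in D then p m v else 0 by rewrite /f mcoeff_sumU.
have pv m : p m v = if m \in D then p m v else 0.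
  case: ifPn => // mD; rewrite {1}vD linear_sum big_seq big1 // => n nD.
  by rewrite (pF n) //; case: eqVneq => // nm; rewrite -nm nD in mD.
exists f; split=> [|g [gF gv]].
  split=> [m|]; first by rewrite fE -pv; apply: Fp.
  have fD : (msupp f `<=` D)%fset.
    by apply/fsubsetP => m; rewrite -mcoeff_neq0 fE; case: ifP => // _; rewrite eqxx.
  rewrite (big_fset_incl _ fD) => [|m _ /mcoeff_outdom //].
  by rewrite {1}vD; apply: eq_bigr => m _; rewrite fE -pv.
apply/malgP => m; rewrite fE -pv gv linear_sum.
have [mg|mg] := boolP (m \in msupp g).
  rewrite (big_fsetD1 m) //= (pF m) // eqxx big_seq big1 ?addr0 // => n.
  by rewrite in_fsetD1 => /andP [/negPf nm _]; rewrite (pF n) // nm.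
rewrite (mcoeff_outdom mg) big_seq big1 // => n ng.
by rewrite (pF n) //; case: eqVneq => // nm; rewrite -nm ng in mg.
Qed.

(* The algebra [A] is realised inside [B] as the sum of the components
   [B^(xi m)]; [q] moves each component [B^l] onto [B^(xi (pi l))] by a shift in
   the centroid, and the product of [A] is [q (x ** y)]. *)
Section ShiftRetract.
Context {k : fieldType} {L M : zmodType} (G : zmodClosed L) (pi : {additive L -> M}).
Hypothesis pi_ker : forall l, (l \in G) = (pi l == 0).
Context (B : graded_algebra k L) (xi : M -> L) (xiK : cancel xi pi).
Context (z : L -> centroid B).
Hypothesis zl : forall g, g \in G -> centroid_comp g (z g).
Hypothesis zM : {in G &, forall g h, z (g + h) = z g ** z h}.
Hypothesis z0 : z 0 = centroid1.

Let d l := xi (pi l) - l.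

Let dG l : d l \in G.
Proof. by rewrite pi_ker raddfB /= xiK subrr. Qed.

Let qP l : linear_on (gcomp B l) (centroid_act (z (d l))).
Proof. exact: linear_scale_on. Qed.

Let q : {linear B -> B} := gluing qP.

Let qE l x : gcomp B l x -> q x = centroid_act (z (d l)) x.
Proof. exact: gluingE. Qed.

Let q_gcomp l x : gcomp B l x -> gcomp B (xi (pi l)) (q x).
Proof.
move=> xl; rewrite (qE xl); have := zl (dG l) xl.
by rewrite /d subrK.
Qed.

Let q_id m x : gcomp B (xi m) x -> q x = x.
Proof. by move=> xm; rewrite (qE xm) /d xiK subrr z0. Qed.

Let qK x : q (q x) = q x.
Proof.
move: x; apply: homog_ind => [|x y hx hy|l x xl]; first by rewrite !linear0.
  by rewrite !linearD hx hy.
exact: q_id (q_gcomp xl).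
Qed.

(** Both sides shift [x ** y] by the same total amount: the shifts [d l] and [d m] of the factors
    and the shift of their product add up to [d (l + m)]. *)
Let qM x y : q (x ** y) = q (q x ** q y).
Proof.
move: x y; apply: homog_ind2 => [x|y|x y y' h h'|x x' y h h'|l m x y xl ym].
- by rewrite (linear0 q) !amul0r.
- by rewrite (linear0 q) !amul0l.
- by rewrite amulDr !(linearD q) amulDr (linearD q) h h'.
- by rewrite amulDl !(linearD q) amulDl (linearD q) h h'.
rewrite (qE (gcompM xl ym)) (qE (gcompM (q_gcomp xl) (q_gcomp ym))).
rewrite (qE xl) (qE ym).
have [_ zml _] := centroid_actP (z (d l)); rewrite -zml.
have [_ _ zmr] := centroid_actP (z (d m)).
rewrite -zmr -!centroid_actM -!zM ?dG ?(rpredD (dG _) (dG _)) //;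
  congr (centroid_act (z _) _).
rewrite {}/d !raddfD /= !xiK; set e := xi _.
by rewrite -!addrA (addrCA (- xi (pi m))) addKr (addrCA (- l)) addKr.
Qed.

Let fixed : set B := fun x => q x = x.

Let fixed_subspace : is_subspace fixed.
Proof.
split=> [|c x y xq yq]; first exact: linear0.
by rewrite /fixed linearP xq yq.
Qed.

Let carrier : lmodType k := subspace_type fixed_subspace.

Let mul (u v : carrier) : carrier :=
  mk_elt fixed_subspace (qK (elt_val u ** elt_val v)).

Let mul_bilinear : bilinear_for *:%R *:%R mul.
Proof.
have ql c x y w : q ((c *: x + y) ** w) = c *: q (x ** w) + q (y ** w).
  by rewrite amulDl amulZl linearP.
have qr c x y w : q (w ** (c *: x + y)) = c *: q (w ** x) + q (w ** y).
  by rewrite amulDr amulZr linearP.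
by split=> [v c u u'|u c v v']; apply: val_inj; [exact: ql | exact: qr].
Qed.

Let alg : algebra k := mk_algebra mul_bilinear.

Let comp (m : M) : set alg := fun u => gcomp B (xi m) (elt_val u).

Let proj_fixed m (u : alg) : fixed (hc (xi m) (elt_val u)).
Proof. exact: q_id (hc_gcomp _ _). Qed.

Let proj_linear m : linear (fun u : alg => mk_elt fixed_subspace (proj_fixed m u) : alg).
Proof. by move=> c u v; apply: val_inj; rewrite /= linearP. Qed.

Let proj m : {linear alg -> alg} := mk_linear (proj_linear m).

(** [q] sends each homogeneous element to a degree in the image of [xi], so a fixed vector has no
    components elsewhere and is the sum of its projections [proj m]. *)
Let hc_fixed l x : fixed x -> hc l x != 0 -> l = xi (pi l).
Proof.
move=> xq; apply: contraNeq => lxi; rewrite -{}xq; apply/eqP.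
move: x; apply: homog_ind => [|x y hx hy|n x xn]; first by rewrite !linear0.
  by rewrite (linearD q) [LHS](linearD (hc l)) [X in X + _]hx [X in _ + X]hy addr0.
rewrite (hc_homog l (q_gcomp xn)); case: eqVneq => // nl.
by rewrite -nl xiK eqxx in lxi.
Qed.

Let comp_direct : is_direct_sum comp.
Proof.
apply: (is_direct_sum_projections (p := proj)) => [m|m u|m n u um|u].
- split=> [|c u v um vm]; first exact: (gcomp_subspace B _).1.
  exact: (gcomp_subspace B _).2.
- exact: hc_gcomp.
- apply: val_inj; rewrite /= (hc_homog _ um) (can_eq xiK).
  by case: eqP.
exists [fset pi l | l in msupp (decomp (elt_val u))]%fset.
set D := [fset _ | _ in _]%fset.
have sumE : elt_val (\sum_(m <- D) proj m u) = \sum_(m <- D) hc (xi m) (elt_val u).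
  exact: (raddf_sum (val : alg -> B)).
apply/val_inj/(etrans _ (esym sumE)).
apply: hc_inj => l; rewrite linear_sum /=.
under eq_bigr do rewrite (hc_homog l (hc_gcomp _ _)).
have [l0|l0] := eqVneq (hc l (elt_val u)) 0.
  by rewrite l0 big1 // => m _; case: eqVneq => // ->.
have lxi := hc_fixed (subspace_eltP u) l0.
have lD : pi l \in D.
  by apply/imfsetP; exists l => //=; rewrite -mcoeff_neq0.
rewrite (big_fsetD1 _ lD) /= -lxi eqxx big_seq big1 ?addr0 // => m.
rewrite in_fsetD1 => /andP [ml _]; case: eqP => // xml.
by rewrite -xml xiK eqxx in ml.
Qed.

Let compM m n (u v : alg) : comp m u -> comp n v -> comp (m + n) (u ** v).
Proof.
move=> um vn; have := q_gcomp (gcompM um vn).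
by rewrite raddfD /= !xiK.
Qed.

Lemma shifts_cover : exists (A : graded_algebra k M) (phi : {linear B -> A}),
  loop_cover pi phi.
Proof.
pose A : graded_algebra k M := @GradedAlgebra k M alg comp comp_direct compM.
have philin : linear (fun x => mk_elt fixed_subspace (qK x) : A).
  by move=> c x y; apply: val_inj; exact: (linearP q).
have zN l x : centroid_act (z (d l)) (centroid_act (z (- d l)) x) = x.
  by rewrite -centroid_actM -zM ?rpredN // subrr z0.
have zN' l x : centroid_act (z (- d l)) (centroid_act (z (d l)) x) = x.
  by rewrite -centroid_actM -zM ?rpredN // addNr z0.
exists A, (mk_linear philin); split.
- by move=> x y; apply: val_inj; apply: qM.
- by move=> l x xl; apply: q_gcomp.
- move=> l x xl /(congr1 (fun u : A => elt_val u)).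
  rewrite -[LHS]/(q x) (qE xl) -[RHS]/(0 : B) => zx.
  by rewrite -(zN' l x) zx linear0.
move=> l u ul; have xl : gcomp B l (centroid_act (z (- d l)) (elt_val u)).
  have := zl (_ : - d l \in G) ul; rewrite rpredN dG => /(_ isT).
  by rewrite /d opprB subrK.
exists (centroid_act (z (- d l)) (elt_val u)) => //.
by apply: val_inj; rewrite -[LHS]/(q _) (qE xl) zN.
Qed.

End ShiftRetract.

Lemma classB_exists_cover (k : fieldType) (L M : zmodType) (G : zmodClosed L)
    (pi : {additive L -> M}) (B : graded_algebra k L) :
  (forall m, exists l, pi l = m) -> (forall l, (l \in G) = (pi l == 0)) ->
  classB G B ->
  exists (A : graded_algebra k M) (phi : {linear B -> A}), loop_cover pi phi.
Proof.
move=> pi_surj pi_ker /split_shifts [z [zl zM z0]].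
have [xi xiK] := exists_choice pi_surj.
exact: (shifts_cover pi_ker xiK zl zM z0).
Qed.

(** * Twists as different covers by one algebra *)

Section Twists.
Context {k : fieldType} {L M : zmodType} (G : zmodClosed L) (pi : {additive L -> M}).
Hypothesis pi_ker : forall l, (l \in G) = (pi l == 0).
Context (xi : M -> L) (xiK : cancel xi pi).
Context (B : graded_algebra k L).

Let xiG l m : xi l + xi m - xi (l + m) \in G.
Proof. by rewrite pi_ker raddfB raddfD /= !xiK subrr. Qed.

Let lG l : l - xi (pi l) \in G.
Proof. by rewrite pi_ker raddfB /= xiK subrr. Qed.

(** Pulled back to [L], the cocycle of the twist becomes a coboundary: with s(l) = l - xi(pi l) in
    [G], its exponent is s(l + m) - s(l) - s(m). Rescaling [phi] in degree l by chi(s(l)) therefore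
    absorbs the twist. *)
Lemma twist_cover (A : graded_algebra k M) (phi : {linear B -> A}) (chi : L -> k) :
  character_on G chi -> loop_cover pi phi ->
  exists psi : {linear B -> twist xi chi A}, loop_cover pi psi.
Proof.
move=> [chi0 chiM] [phiM phil phi0 phi_surj].
pose f l (x : B) : A := chi (l - xi (pi l)) *: phi x.
have fP l : linear_on (gcomp B l) (f l).
  by move=> c x y _ _; rewrite /f linearP scalerDr !scalerA mulrC.
pose psi : {linear B -> twist xi chi A} := gluing fP.
have psiE l x : gcomp B l x -> psi x = chi (l - xi (pi l)) *: phi x.
  exact: (gluingE fP).
exists psi; split.
- apply: morph_homog => l m x y xl ym.
  rewrite -[RHS]/(@twist_mul _ _ _ xi chi A (psi x) (psi y)).
  rewrite (psiE _ _ xl) (psiE _ _ ym) (psiE _ _ (gcompM xl ym)) phiM.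
  rewrite (@twist_mul_homog _ _ _ _ _ _ (pi l) (pi m)); last 2 first.
  - by apply: subspaceZ (gcomp_subspace A _) _; apply: phil.
  - by apply: subspaceZ (gcomp_subspace A _) _; apply: phil.
  rewrite amulZl amulZr !scalerA -!chiM ?xiG ?lG ?(rpredD (lG _) (lG _)) //.
  rewrite (raddfD pi) /= (addrACA l) -opprD; congr (chi _ *: _).
  by rewrite [RHS]addrC addrA subrK.
- move=> l x xl; rewrite (psiE _ _ xl).
  by apply: subspaceZ (gcomp_subspace A _) _; apply: phil.
- move=> l x xl; rewrite (psiE _ _ xl) => /eqP.
  rewrite scaler_eq0 (negPf (chi0 _ (lG l))) /= => /eqP; exact: phi0 xl.
move=> l a al.
have [x xl xa] :=
  phi_surj l _ (subspaceZ (chi (l - xi (pi l)))^-1 (gcomp_subspace A _) al).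
by exists x; rewrite // (psiE _ _ xl) xa scalerA mulfV ?scale1r // chi0.
Qed.

(* The cocycle of the twist compares the two specializations on the shifts: a
   shift [t] of degree [xi m + xi n - xi (m + n)] with [rho' t = 1] carries a
   lift of [a ** b] to the product of the lifts of [a] and [b]. *)
Lemma covers_twist_similar (A A' : graded_algebra k M)
    (phi : {linear B -> A}) (phi' : {linear B -> A'}) :
  (forall m, exists l, pi l = m) -> classA A -> classA A' ->
  loop_cover pi phi -> loop_cover pi phi' -> twist_similar G xi A A'.
Proof.
move=> pi_surj csA csA' cov cov'.
have [rho [rho1 rhoM] [_ _ _ _ rhoE]] := cover_specialization pi_surj cov csA.
have [phiM phil phi0 _] := cov; have [phiM' phil' _ _] := cov'.
have [t [tl tM t0 phit]] := cover_shifts cov' pi_ker.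
have rt g : g \in G -> rho (t g) * rho (t (- g)) = 1.
  by move=> gG; rewrite -rhoM -tM ?rpredN // subrr t0.
have rt0 g : g \in G -> rho (t g) != 0.
  by move=> /rt; apply: contra_eq_neq => ->; rewrite mul0r eq_sym oner_neq0.
(* The shift [t g] acts as 1 through [phi'] and as [rho (t g)] through [phi]; the inverse cancels
   this factor in the twisted product. *)
exists (fun g => (rho (t g))^-1).
  split=> [g gG|g h gG hG]; first by rewrite invr_eq0 rt0.
  by rewrite tM // rhoM invfM.
have phix m x : gcomp B (xi m) x -> gcomp A m (phi x) by move/phil; rewrite xiK.
have phix' m x : gcomp B (xi m) x -> gcomp A' m (phi' x) by move/phil'; rewrite xiK.
have lP m a : gcomp A m a ->
    gcomp B (xi m) (cover_lift phi (xi m) a) /\ phi (cover_lift phi (xi m) a) = a.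
  by move=> am; apply: (cover_liftP cov); rewrite xiK.
have lP' m a : gcomp A' m a ->
    gcomp B (xi m) (cover_lift phi' (xi m) a) /\ phi' (cover_lift phi' (xi m) a) = a.
  by move=> am; apply: (cover_liftP cov'); rewrite xiK.
have fP m : linear_on (gcomp A m) (fun a => phi' (cover_lift phi (xi m) a)).
  move=> c a b am bm; rewrite (cover_lift_linear cov) ?xiK //; exact: linearP.
have fP' m : linear_on (gcomp A' m) (fun a => phi (cover_lift phi' (xi m) a)).
  move=> c a b am bm; rewrite (cover_lift_linear cov') ?xiK //; exact: linearP.
set chi := fun g => (rho (t g))^-1.
(* Both algebras are identified with the sum of the components B^(xi m), on each of which [phi] and
   [phi'] are bijective onto degree m. *)
pose f' : {linear A' -> twist xi chi A} := gluing fP'.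
pose f : {linear A -> A'} := gluing fP.
have f'E m x : gcomp B (xi m) x -> f' (phi' x) = phi x.
  move=> xm; rewrite [LHS](gluingE fP' (phix' _ _ xm)).
  by rewrite (cover_liftK cov').
have fE m x : gcomp B (xi m) x -> f (phi x) = phi' x.
  move=> xm; rewrite [LHS](gluingE fP (phix _ _ xm)).
  by rewrite (cover_liftK cov).
apply: (giso_intro (f := f') (g := f : twist xi chi A -> A')).
- apply: homog_ind => [|a b ha hb|m a am]; first by rewrite !linear0.
    by rewrite !linearD ha hb.
  by have [xm <-] := lP' _ _ am; rewrite (f'E _ _ xm) (fE _ _ xm).
- apply: (homog_ind (A := A)) => [|a b ha hb|m a am]; first by rewrite !linear0.
    by rewrite !linearD ha hb.
  by have [xm <-] := lP _ _ am; rewrite (fE _ _ xm) (f'E _ _ xm).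
- apply: morph_homog => m n a b am bn.
  have [xm <-] := lP' _ _ am; have [yn <-] := lP' _ _ bn.
  move: (cover_lift phi' _ a) (cover_lift phi' _ b) xm yn => x y xm yn {a b am bn}.
  rewrite -[RHS]/(@twist_mul _ _ _ xi chi A (f' (phi' x)) (f' (phi' y))).
  rewrite (f'E _ _ xm) (f'E _ _ yn).
  rewrite (twist_mul_homog xi chi (phix _ _ xm) (phix _ _ yn)) -phiM -phiM'.
  set g := xi m + xi n - xi (m + n).
  have xyl : gcomp A' (m + n) (phi' (x ** y)).
    by rewrite phiM'; apply: gcompM; apply: phix'.
  have [wl wE] := lP' _ _ xyl; rewrite -{1}wE (f'E _ _ wl).
  move: (cover_lift _ _ _) wl wE => w wl wE.
  have gG : g \in G by apply: xiG.
  have <- : centroid_act (t g) w = x ** y.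
    apply: (cover_inj cov' (l := xi m + xi n)).
    - by have := tl _ gG _ _ wl; rewrite /g subrK.
    - exact: gcompM.
    by rewrite phit // wE.
  by rewrite rhoE scalerA mulVf ?scale1r // rt0.
- move=> m a am; have [xm <-] := lP' _ _ am.
  by rewrite (f'E _ _ xm); apply: phix.
move=> m a am; have [xm <-] := lP _ _ am.
by rewrite (fE _ _ xm); apply: phix'.
Qed.

End Twists.

(** * Finite dimension and finite generation over the centroid *)

Section FiniteDimension.
Context {k : fieldType} {L M : zmodType} (G : zmodClosed L) (pi : {additive L -> M}).
Hypothesis pi_surj : forall m, exists l, pi l = m.
Hypothesis pi_ker : forall l, (l \in G) = (pi l == 0).
Context (B : graded_algebra k L) (A : graded_algebra k M) (phi : {linear B -> A}).
Hypothesis cov : loop_cover pi phi.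

(** Applying [phi] to an expansion over the centroid turns its coefficients into scalars through
    [rho], so the images of the generators span [A]. *)
Lemma fgc_cover_finite_dimensional :
  central_simple A -> fgc B -> finite_dimensional A.
Proof.
move=> csA [n [e eP]].
have [rho _ [_ _ _ _ rhoE]] := cover_specialization pi_surj cov csA.
exists n, (fun i => phi (e i)) => a.
have [x <-] := cover_surj cov pi_surj a; have [c ->] := eP x.
by exists (fun i => rho (c i)); rewrite linear_sum; apply: eq_bigr => i _; apply: rhoE.
Qed.

Lemma fgc_finType (I : finType) (e : I -> B) :
  (forall x, exists c : I -> centroid B, x = \sum_i centroid_act (c i) (e i)) ->
  fgc B.
Proof.
move=> eP; exists #|I|, (fun i => e (enum_val i)) => x; have [c ->] := eP x.
by exists (fun i => c (enum_val i)); rewrite big_enum_val.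
Qed.

(* The homogeneous components of a spanning set of [A] lift to generators of
   [B] over the shifts. *)
Lemma finite_dimensional_cover_fgc : finite_dimensional A -> fgc B.
Proof.
move=> [n [e eP]]; have [xi xiK] := exists_choice pi_surj.
have [z [zl _ _ phiz]] := cover_shifts cov pi_ker.
pose D := \big[fsetU/fset0]_(i : 'I_n) msupp (decomp (e i)).
have De m i : m \notin D -> hc m (e i) = 0.
  move=> mD; apply: mcoeff_outdom; apply: contra mD => me.
  by apply/bigfcupP; exists i; rewrite ?mem_index_enum.
pose b (ij : 'I_n * D) := cover_lift phi (xi (val ij.2)) (hc (val ij.2) (e ij.1)).
have bP ij : gcomp B (xi (val ij.2)) (b ij) /\ phi (b ij) = hc (val ij.2) (e ij.1).
  by apply: (cover_liftP cov); rewrite xiK; apply: hc_gcomp.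
apply: (fgc_finType (e := b)); apply: homog_ind => [|x y [c xc] [d yd]|l x xl].
- by exists (fun=> 0); rewrite big1.
- exists (fun i => c i + d i); rewrite xc yd -big_split.
  by apply: eq_bigr => i _; rewrite -[X in _ = centroid_act (X + _) _]scale1r
    centroid_actPl scale1r.
have [a xa] := eP (phi x); have [_ phil phi0 _] := cov.
have xE : phi x = \sum_i a i *: hc (pi l) (e i).
  rewrite -[LHS](hc_id (phil _ _ xl)) xa linear_sum.
  by apply: eq_bigr => i _; rewrite linearZ.
have [lD|lD] := boolP (pi l \in D); last first.
  exists (fun=> 0); rewrite big1 //; apply: (phi0 l) => //.
  by rewrite xE big1 // => i _; rewrite De // scaler0.
pose j0 : D := [` lD]%fset.
(* Only the generators of degree [xi (pi l)] are used, each moved to degree [l] by the shift of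
   degree [l - xi (pi l)]. *)
pose c (ij : 'I_n * D) : centroid B :=
  if ij.2 == j0 then a ij.1 *: z (l - xi (pi l)) else 0.
have gG : l - xi (pi l) \in G by rewrite pi_ker raddfB /= xiK subrr.
exists c; apply: (cover_inj cov xl).
  apply: subspace_sum (gcomp_subspace B l) _ => -[i j] _; rewrite /c /=.
  case: eqP => [->|_]; last exact: (gcomp_subspace B l).1.
  rewrite centroid_actZ; apply: subspaceZ (gcomp_subspace B l) _.
  by have := zl _ gG _ _ (bP (i, j0)).1; rewrite subrK.
have -> : phi (\sum_ij centroid_act (c ij) (b ij)) =
    \sum_i \sum_j phi (centroid_act (c (i, j)) (b (i, j))).
  by rewrite linear_sum pair_bigA; apply: eq_bigr => -[].
rewrite xE; apply: eq_bigr => i _.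
rewrite (bigD1 j0) //= big1 => [|j /negPf jj0]; last first.
  by rewrite /c /= jj0 centroid_act0 linear0.
by rewrite addr0 /c /= eqxx centroid_actZ linearZ /= phiz // (bP (i, j0)).2.
Qed.

End FiniteDimension.

Theorem theorem7p1p1 (k : fieldType) (L M : zmodType) (G : zmodClosed L)
    (pi : {additive L -> M})
    (pi_surj : forall m : M, exists l : L, pi l = m)
    (pi_ker : forall l : L, (l \in G) = (pi l == 0)) :
  [/\ (* (i) *)
      forall A : graded_algebra k M,
        classA A -> classB G (loop_algebra pi A),
      (* (ii) *)
      forall B : graded_algebra k L, classB G B ->
        (exists A : graded_algebra k M,
           classA A /\ giso (loop_algebra pi A) B) /\
        (forall A : graded_algebra k M,
           (classA A /\ giso (loop_algebra pi A) B) <-> central_image pi B A),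
      (* (iii) *)
      forall xi : M -> L, cancel xi pi ->
        forall A A' : graded_algebra k M, classA A -> classA A' ->
          (giso (loop_algebra pi A) (loop_algebra pi A') <->
           twist_similar G xi A A') &
      (* (iv) *)
      forall (A : graded_algebra k M) (B : graded_algebra k L),
        classA A -> classB G B -> giso B (loop_algebra pi A) ->
        (finite_dimensional A <-> fgc B)].
Proof.
split.
- move=> A csA; have [phi cov] := loop_algebra_cover pi A.
  exact: (cover_classB pi_surj pi_ker cov csA).
- move=> B clB; split.
    have [A [phi cov]] := classB_exists_cover pi_surj pi_ker clB.
    exists A; split; first exact: (classB_cover_central_simple pi_surj pi_ker clB cov).
    by apply/loop_coverP; exists phi.
  move=> A; split=> [[csA /loop_coverP [phi cov]]|[rho rhoP [phi phiP]]].
    have [rho rhoP phiP] := cover_specialization pi_surj cov csA.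
    by exists rho => //; exists phi.
  have cov := specialization_cover pi_ker clB rhoP phiP.
  split; first exact: (classB_cover_central_simple pi_surj pi_ker clB cov).
  by apply/loop_coverP; exists phi.
(* The loop algebra of [A] covers [A], and an isomorphism with that of [A'] amounts to its covering
   [A'] too; both directions thus compare two covers by one algebra. *)
- move=> xi xiK A A' csA csA'; have [can cov] := loop_algebra_cover pi A.
  split=> [/giso_sym /loop_coverP [psi cov']|[chi chiP /giso_sym A'A]].
    exact: (covers_twist_similar pi_ker xiK pi_surj csA csA' cov cov').
  have [psi cov'] := twist_cover pi_ker xiK chiP cov.
  have [psi' cov''] := cover_loop_giso cov' A'A.
  by apply/giso_sym/loop_coverP; exists psi'.
move=> A B csA _ /giso_sym /loop_coverP [phi cov]; split.
  exact: (finite_dimensional_cover_fgc pi_surj pi_ker cov).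
exact: (fgc_cover_finite_dimensional pi_surj cov csA).
Qed.
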